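(* Fix any rule $\mathrm{Comp}$ that assigns to every connected undirected signed graph $G=(V,E)$ a binary relation $\mathrm{Comp}_G\subseteq V\times V$ which is reflexive and symmetric and satisfies (1) positive edge compatibility: for every edge $(u,v)\in E$ with $\mathrm{sign}(u,v)=+1$, $(u,v)\in\mathrm{Comp}_G$; and (2) negative edge incompatibility: for every edge $(u,v)\in E$ with $\mathrm{sign}(u,v)=-1$, $(u,v)\notin\mathrm{Comp}_G$. Then the following decision problem (the decision version of TFSNC) is NP-hard: given a connected signed graph $G=(V,E)$, a universe of skills $S$, a skill assignment $\mathrm{skill}:V\to 2^{S}$, and a task $T\subseteq S$, decide whether there exists a set $X\subseteq V$ such that $\bigcup_{u\in X}\mathrm{skill}(u)\supseteq T$ and $(u,v)\in\mathrm{Comp}_G$ for all $u,v\in X$.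
   Context: An undirected signed graph is $G=(V,E)$ with $E\subseteq\{(u,v,\ell): u,v\in V,\ \ell\in\{+1,-1\}\}$, each pair of distinct nodes joined by at most one edge; $\mathrm{sign}(u,v)=\ell$ denotes the label of the edge $(u,v,\ell)$. Positive edges indicate friendship and negative edges enmity. Throughout, the graph $G$ is assumed connected. Each node (individual) $u$ possesses a set of skills $\mathrm{skill}(u)\subseteq S$. *)

(* Defs.v *)
From HB Require Import structures.
From mathcomp Require Import all_boot all_order all_algebra.
Set Implicit Arguments.
Unset Strict Implicit.
Unset Printing Implicit Defensive.

(** * Polynomial time, NP and NP-hardness, over deterministic multitape Turing
    machines *)

Definition word := seq bool.
Definition language := word -> Prop.

(* A tape cell: [None] is the blank, [Some (inl b)] a bit, and [Some (inr a)]
   one of the machine's own work symbols. *)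
Definition cell (A : finType) : finType := option (bool + A)%type.

Variant direction := MoveLeft | Stay | MoveRight.

(* A two-way infinite tape: the scanned cell is the head of [tape_right], the
   cells on its left are listed in [tape_left] from the nearest one, and all
   cells beyond either list are blank. *)
Record tape (A : finType) := Tape {
  tape_left : seq (cell A);
  tape_right : seq (cell A)
}.

Section Tapes.
Variable A : finType.
Implicit Type t : tape A.

Definition blank_tape : tape A := Tape [::] [::].

Definition word_tape (x : word) : tape A :=
  Tape [::] [seq Some (inl b) | b <- x].

Definition tape_read t : cell A := head None (tape_right t).

Definition tape_write (c : cell A) t : tape A :=
  Tape (tape_left t) (c :: behead (tape_right t)).

Definition tape_move (d : direction) t : tape A :=
  let: Tape l r := t in
  match d with
  | MoveLeft => Tape (behead l) (head None l :: r)
  | Stay => t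
  | MoveRight => Tape (head None r :: l) (behead r)
  end.

(* The word read from a tape is the maximal block of bits that starts at the
   scanned cell and extends to the right. *)
Fixpoint bit_prefix (s : seq (cell A)) : word :=
  if s is Some (inl b) :: s' then b :: bit_prefix s' else [::].

Definition tape_word t : word := bit_prefix (tape_right t).

End Tapes.

(* There are [tm_tapes.+1] tapes; the first holds the input and the last the
   output (they coincide when [tm_tapes = 0]). *)
Record turing_machine := TuringMachine {
  tm_tapes : nat;
  tm_aux : finType;
  tm_state : finType;
  tm_start : tm_state;
  tm_halted : pred tm_state;
  tm_trans : tm_state -> {ffun 'I_tm_tapes.+1 -> cell tm_aux} ->
    tm_state * {ffun 'I_tm_tapes.+1 -> cell tm_aux} *
    ('I_tm_tapes.+1 -> direction)
}.

Section Runs.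
Variable M : turing_machine.

Definition config : Type :=
  tm_state M * {ffun 'I_(tm_tapes M).+1 -> tape (tm_aux M)}.

Definition tm_init (x : word) : config :=
  (tm_start M,
   [ffun i => if i == ord0 then word_tape (tm_aux M) x
              else blank_tape (tm_aux M)]).

Definition tm_step (c : config) : config :=
  let: (q, t) := c in
  if tm_halted q then c else
  let: (q', w, d) := tm_trans q [ffun i => tape_read (t i)] in
  (q', [ffun i => tape_move (d i) (tape_write (w i) (t i))]).

Definition tm_outputs_within (n : nat) (x y : word) : Prop :=
  let: (q, t) := iter n tm_step (tm_init x) in
  tm_halted q /\ tape_word (t ord_max) = y.

End Runs.

Definition polytime_function (f : word -> word) : Prop :=
  exists (M : turing_machine) (p : {poly nat}),
    forall x, tm_outputs_within M p.[size x]%R x (f x).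

Definition polytime_language (L : language) : Prop :=
  exists2 f, polytime_function f & forall x,
    (L x -> f x = [:: true]) /\ (~ L x -> f x = [:: false]).

(* A self-delimiting pairing: each bit of [x] is preceded by [true], and
   [false] marks the end of [x]. *)
Definition word_pair (x y : word) : word :=
  flatten [seq [:: true; b] | b <- x] ++ false :: y.

Definition in_NP (L : language) : Prop :=
  exists (V : language) (p : {poly nat}),
    polytime_language V /\
    forall x, L x <-> exists2 y, size y <= p.[size x]%R & V (word_pair x y).

Definition polytime_reducible (L1 L2 : language) : Prop :=
  exists2 f, polytime_function f & forall x, L1 x <-> L2 (f x).

Definition NP_hard (L : language) : Prop :=
  forall L', in_NP L' -> polytime_reducible L' L.

(** * Connected signed graphs and team formation *)

Section SignedGraphs.
Variable V : finType.

(* [(u, v, true)] is a positive edge and [(u, v, false)] a negative one; an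
   undirected edge is stored in both orientations. *)
Implicit Type E : {set V * V * bool}.

Definition loopless E := [forall u, forall l, (u, u, l) \notin E].

Definition undirected E :=
  [forall u, forall v, forall l, ((u, v, l) \in E) == ((v, u, l) \in E)].

Definition simply_signed E :=
  [forall u, forall v, ~~ (((u, v, true) \in E) && ((u, v, false) \in E))].

Definition adjacent E : rel V := [rel u v | [exists l, (u, v, l) \in E]].

Definition graph_connected E := [forall u, forall v, connect (adjacent E) u v].

Record connected_signed_graph := ConnectedSignedGraph {
  edges : {set V * V * bool};
  edges_axiom : [&& loopless edges, undirected edges, simply_signed edges
                  & graph_connected edges]
}.

End SignedGraphs.

Definition compatibility_rule : Type :=
  forall V : finType, connected_signed_graph V -> V -> V -> Prop.

Record tfsnc_instance := TfsncInstance {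
  num_nodes : nat;
  num_skills : nat;
  graph : connected_signed_graph 'I_num_nodes;
  skill : {ffun 'I_num_nodes -> {set 'I_num_skills}};
  task : {set 'I_num_skills}
}.

Definition tfsnc_yes (Comp : compatibility_rule) (I : tfsnc_instance) : Prop :=
  exists X : {set 'I_(num_nodes I)},
    task I \subset \bigcup_(u in X) skill I u /\
    forall u v, u \in X -> v \in X -> Comp _ (graph I) u v.

(* Both cardinalities in unary, followed by the bit tables of the edge set (two
   bits per ordered pair of nodes), of the skill assignment and of the task. *)
Definition tfsnc_encode (I : tfsnc_instance) : word :=
  nseq (num_nodes I) true ++ false ::
  nseq (num_skills I) true ++ false ::
  flatten [seq [:: (u, v, true) \in edges (graph I);
                   (u, v, false) \in edges (graph I)]
          | u <- enum 'I_(num_nodes I), v <- enum 'I_(num_nodes I)] ++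
  [seq s \in skill I u
  | u <- enum 'I_(num_nodes I), s <- enum 'I_(num_skills I)] ++
  [seq s \in task I | s <- enum 'I_(num_skills I)].

Lemma nseq_cat_inj m n (s t : word) :
  nseq m true ++ false :: s = nseq n true ++ false :: t -> m = n /\ s = t.
Proof.
elim: m n => [|m IHm] [|n] //=; first by case.
by case=> /IHm [-> ->].
Qed.

Lemma tfsnc_encode_inj : injective tfsnc_encode.
Proof.
case=> n m G sk T [n' m' G' sk' T'].
rewrite /tfsnc_encode /= => /nseq_cat_inj [en /nseq_cat_inj [em]].
move: en em G' sk' T' => <- <- G' sk' T' /eqP.
rewrite eqseq_cat; last first.
  by rewrite !size_flatten /shape !map_allpairs.
case/andP=> /eqP eE; rewrite eqseq_cat ?size_allpairs // => /andP[/eqP eS /eqP eT].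
have -> : T = T'.
  by apply/setP=> s; move/eq_in_map: eT; apply; rewrite mem_enum.
have -> : sk = sk'.
  apply/ffunP=> u; apply/setP=> s; move/eq_in_allpairs: eS.
  by apply; rewrite mem_enum.
suff -> : G = G' by [].
have {}eE : edges G = edges G'.
  have {}eE : forall u v, [:: (u, v, true) \in edges G; (u, v, false) \in edges G]
              = [:: (u, v, true) \in edges G'; (u, v, false) \in edges G'].
    pose f (H : connected_signed_graph 'I_n) u v :=
      [:: (u, v, true) \in edges H; (u, v, false) \in edges H].
    have fK H : reshape (nseq (n * n) 2) (flatten [seq f H u v | u <- enum 'I_n, v <- enum 'I_n])
        = [seq f H u v | u <- enum 'I_n, v <- enum 'I_n].
      rewrite -[RHS]flattenK; congr reshape.
      rewrite /shape map_allpairs /=.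
      have -> : n * n = size [seq 2 | u <- enum 'I_n, v <- enum 'I_n].
        by rewrite size_allpairs size_enum_ord.
      apply/esym/all_pred1P/allP=> _ /allpairsP[p [_ _ ->]].
      by rewrite /= eqxx.
    move=> u v; have := congr1 (reshape (nseq (n * n) 2)) eE.
    rewrite (fK G) (fK G') => /eq_in_allpairs.
    by apply; rewrite mem_enum.
  by apply/setP=> -[[u v] []]; case: (eE u v).
case: G G' eE {T T' sk sk' eS eT} => E hE [E' hE'] /= eE.
by case: _ / eE hE' => hE'; rewrite (bool_irrelevance hE hE').
Qed.

Definition TFSNC (Comp : compatibility_rule) : language :=
  fun w => exists2 I, w = tfsnc_encode I & tfsnc_yes Comp I.

(* Main.v *)
Require Import Defs.
From Stdlib Require Import Classical FunctionalExtensionality.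
From HB Require Import structures.
From mathcomp Require Import all_boot all_order all_algebra zify.

(* On a complete signed graph every compatibility rule coincides with the positive
   edges, so TFSNC contains every binary constraint satisfaction problem: the
   variables are the skills, the nodes are the pairs (variable, value), a node has
   its variable as only skill, or no skill if its value violates a unary
   constraint, and two nodes are joined negatively when they violate a binary
   constraint.

   A polynomially bounded computation of a verifier is such a problem. Its
   variables are the pairs (time, offset relative to the heads) and its values the
   local views of a configuration (state, scanned symbols, and the tape contents
   at three consecutive offsets); neighbouring views determine each other. The
   borders of the tableau are left unconstrained: errors coming from there move
   inwards by one cell per step and do not reach the heads in time.

   The reduction is a term of a small functional language, whose only iteration
   concatenates the results of independent runs of its body. Every such term is
   polynomially bounded, and it is compiled to programs over stacks and then to
   Turing machines, whose states are the continuations of the program. *)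

Set Implicit Arguments.
Unset Strict Implicit.
Unset Printing Implicit Defensive.

(** * Stack programs and their Turing machines *)

Inductive prog :=
| Skip
| Push of nat & bool
| Pop of nat
| Seq of prog & prog
| Test of nat & prog & prog & prog
| While of nat & prog.

Lemma prog_comparable : comparable prog.
Proof. by rewrite /comparable /decidable; decide equality; apply: eq_comparable. Qed.

HB.instance Definition _ := hasDecEq.Build prog (compareP prog_comparable).

Definition store := nat -> word.

Definition upd (st : store) r w : store := fun i => if i == r then w else st i.

Definition cont_step (rd : nat -> option bool) (k : seq prog) : seq prog :=
  match k with
  | Seq p q :: k' => p :: q :: k'
  | Test r pe pf pt :: k' =>
      (if rd r is Some b then if b then pt else pf else pe) :: k'
  | While r p :: k' => if rd r is Some _ then p :: k else k'
  | _ :: k' => k'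
  | [::] => [::]
  end.

Definition store_step (k : seq prog) (st : store) : store :=
  match k with
  | Push r b :: _ => upd st r (b :: st r)
  | Pop r :: _ => upd st r (behead (st r))
  | _ => st
  end.

Definition prog_step (c : seq prog * store) : seq prog * store :=
  (cont_step (fun r => ohead (c.2 r)) c.1, store_step c.1 c.2).

(** Quantifying over every continuation [k] makes runs compose sequentially; [n] is only an upper
    bound, so that it can be relaxed. *)
Definition runs p st st' n :=
  exists2 m, m <= n & forall k, iter m prog_step (p :: k, st) = (k, st').

Fixpoint max_reg p : nat :=
  match p with
  | Skip => 0
  | Push r _ | Pop r => r
  | Seq p q => maxn (max_reg p) (max_reg q)
  | Test r p q s => maxn r (maxn (max_reg p) (maxn (max_reg q) (max_reg s)))
  | While r p => maxn r (max_reg p)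
  end.

(** Covers the continuations met between starting [p] and reaching [k]. The list stays finite even
    for [While], whose body returns to the continuation [p :: k] already listed; this gives the
    machine its finite state set. *)
Fixpoint conts p (k : seq prog) : seq (seq prog) :=
  (p :: k) ::
  match p with
  | Seq a b => conts a (b :: k) ++ conts b k
  | Test _ a b c => conts a k ++ conts b k ++ conts c k
  | While _ a => conts a (p :: k)
  | _ => [::]
  end.

Lemma mem_conts p k : p :: k \in conts p k.
Proof. by case: p => *; rewrite /= mem_head. Qed.

Lemma cont_step_closed rd p k c :
  c \in conts p k -> cont_step rd c \in k :: conts p k.
Proof.
elim: p k c => [|r b|r|p IHp q IHq|r p IHp q IHq s IHs|r p IHp] k c /=;
  try by rewrite inE => /eqP ->; rewrite mem_head.
- rewrite inE mem_cat => /orP[/eqP -> /=|/orP[/IHp|/IHq]].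
  + by rewrite !inE !mem_cat mem_conts !orbT.
  + rewrite !inE !mem_cat => /orP[/eqP ->|->]; last by rewrite !orbT.
    by rewrite mem_conts !orbT.
  + by rewrite !inE !mem_cat => /orP[->|->]; rewrite ?orbT.
- rewrite inE !mem_cat => /orP[/eqP -> /=|/or3P[/IHp|/IHq|/IHs]].
  + rewrite !inE !mem_cat.
    by case: (rd r) => [[]|]; rewrite mem_conts !orbT.
  + by rewrite !inE !mem_cat => /orP[->|->]; rewrite ?orbT.
  + by rewrite !inE !mem_cat => /orP[->|->]; rewrite ?orbT.
  + by rewrite !inE !mem_cat => /orP[->|->]; rewrite ?orbT.
- rewrite inE => /orP[/eqP -> /=|/IHp].
  + by rewrite !inE; case: (rd r) => [_|]; rewrite ?mem_conts ?eqxx ?orbT.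
  + by rewrite !inE => /orP[->|->]; rewrite ?orbT.
Qed.

(** Keeps every register met during a run within [K], so that [inord r] in [prog_trans] denotes tape
    [r]. *)
Lemma conts_max_reg p k c :
  c \in conts p k ->
  all (fun q => max_reg q <= maxn (max_reg p) (foldr maxn 0 (map max_reg k))) c.
Proof.
have allk (l : seq prog) m : foldr maxn 0 (map max_reg l) <= m ->
    all (fun q => max_reg q <= m) l.
  elim: l m => //= q l IHl m; rewrite geq_max => /andP[-> /IHl ->] //.
move=> c_in; apply: allk; move: c_in.
elim: p k c => [|r b|r|p IHp q IHq|r p IHp q IHq s IHs|r p IHp] k c /=;
  try by rewrite inE => /eqP -> /=.
- rewrite inE mem_cat => /orP[/eqP -> //=|/orP[/IHp|/IHq] /=]; lia.
- rewrite inE !mem_cat => /orP[/eqP -> //=|/or3P[/IHp|/IHq|/IHs]]; lia.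
- rewrite inE => /orP[/eqP -> //=|/IHp /=]; lia.
Qed.

Section Compile.

Variables (p : prog) (K : nat).
Hypothesis pK : max_reg p <= K.

Let L := [::] :: conts p [::].

Definition prog_state : finType := ('I_(size L) * bool)%type.

Definition state_cont (q : prog_state) : seq prog := nth [::] L q.1.

Definition cont_state (c : seq prog) (b : bool) : prog_state := (inord (index c L), b).

Lemma cont_stateK c b : c \in L -> state_cont (cont_state c b) = c.
Proof.
move=> cL; rewrite /state_cont /cont_state /= inordK ?nth_index //.
by have := cL; rewrite -index_mem.
Qed.

Definition cell_bit (c : cell void) : option bool :=
  if c is Some (inl b) then Some b else None.

(* Pushing needs two machine steps, a move to the left and a write, so every
   program step is run as two machine steps; the boolean of the state tells them
   apart. *)
Definition prog_trans (q : prog_state) (rd : {ffun 'I_K.+1 -> cell void}) :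
    prog_state * {ffun 'I_K.+1 -> cell void} * ('I_K.+1 -> direction) :=
  let c := state_cont q in
  if ~~ q.2 then
    (cont_state c true, rd,
     fun i => if c is Push r _ :: _ then
                if i == inord r then MoveLeft else Stay
              else Stay)
  else
    (cont_state (cont_step (fun r => cell_bit (rd (inord r))) c) false,
     [ffun i => match c with
                | Push r b :: _ => if i == inord r then Some (inl b) else rd i
                | Pop r :: _ => if i == inord r then None else rd i
                | _ => rd i
                end],
     fun i => if c is Pop r :: _ then
                if i == inord r then MoveRight else Stay
              else Stay).

Definition prog_machine : turing_machine :=
  @TuringMachine K void prog_state (cont_state [:: p] false)
    (fun q => nilp (state_cont q)) prog_trans.

(** The left part is unconstrained because [Push] overwrites the cell it moves onto. The trailing
    blanks account for explicit [None] cells, written back when an empty stack is read. *)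
Definition tape_holds (t : tape void) (s : word) :=
  exists m, tape_right t = [seq Some (inl b) | b <- s] ++ nseq m None.

Lemma tape_holds_read t s : tape_holds t s -> cell_bit (tape_read t) = ohead s.
Proof. by case=> m; rewrite /tape_read => ->; case: s m => [|b s] [|m]. Qed.

Lemma tape_holds_keep t s : tape_holds t s ->
  tape_holds (tape_move Stay (tape_write (tape_read t) t)) s.
Proof.
case: t => l r [m] /= ->; case: s m => [|b s] [|m] /=.
- by exists 1.
- by exists m.+1.
- by exists 0.
- by exists m.+1.
Qed.

Lemma tape_holds_pop t s : tape_holds t s ->
  tape_holds (tape_move MoveRight (tape_write None t)) (behead s).
Proof.
case: t => l r [m] /= ->; case: s m => [|b s] [|m] /=.
- by exists 0.
- by exists m.
- by exists 0.
- by exists m.+1.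
Qed.

Lemma tape_holds_push t s b : tape_holds t s ->
  tape_holds (tape_move Stay (tape_write (Some (inl b))
    (tape_move MoveLeft (tape_write (tape_read t) t)))) (b :: s).
Proof.
move/tape_holds_keep => [m]; case: t => l r /= e.
by exists m; rewrite /= e.
Qed.

Definition simulates (c : seq prog * store) (C : config prog_machine) :=
  [/\ c.1 \in L, C.1 = cont_state c.1 false
    & forall i : 'I_K.+1, tape_holds (C.2 i) (c.2 i)].

Lemma simulates_step c C : simulates c C ->
  simulates (prog_step c) (iter 2 (@tm_step prog_machine) C).
Proof.
case: c C => [k st] [q t] [/= kL -> tst].
have kreg : all (fun q => max_reg q <= K) k.
  move: kL; rewrite /L inE => /orP[/eqP -> //|/conts_max_reg].
  by rewrite /= maxn0; apply: sub_all => q' /leq_trans; apply.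
have stL rd : cont_step rd k \in L.
  move: kL; rewrite {1}/L inE => /orP[/eqP -> //|/cont_step_closed]; exact.
rewrite /tm_step /= cont_stateK //.
case: (@nilP _ k) => [k0|knil].
  by rewrite k0 /prog_step /= cont_stateK ?mem_head.
rewrite /prog_trans /= !cont_stateK //=.
case: (@nilP _ k) => [//|_]; rewrite /= ?cont_stateK //.
have rd_eq r : r <= K -> forall t' : {ffun 'I_K.+1 -> tape void},
    (forall i : 'I_K.+1, tape_holds (t' i) (st i)) ->
    cell_bit (tape_read (t' (inord r))) = ohead (st r).
  by move=> rK t' /(_ (inord r)); rewrite inordK // => /tape_holds_read.
split=> //=.
- congr cont_state; case: k kreg {kL stL knil}
    => [|[|r b|r|p1 p2|r p1 p2 p3|r p1] k] //= /andP[].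
  + rewrite geq_max => /andP[rK _] _; congr cons; rewrite !ffunE.
    rewrite rd_eq // => i; rewrite !ffunE; exact: tape_holds_keep.
  + rewrite geq_max => /andP[rK _] _; rewrite !ffunE.
    rewrite rd_eq // => i; rewrite !ffunE; exact: tape_holds_keep.
move=> i; rewrite !ffunE.
pose t1 := tape_move Stay (tape_write (tape_read (t i)) (t i)).
have keep2 : tape_holds (tape_move Stay (tape_write (tape_read t1) t1)) (st i).
  by do 2!apply: tape_holds_keep.
case: k kreg {kL stL knil} => [|[|r b|r|p1 p2|r p1 p2 p3|r p1] k] //= /andP[rK _].
- rewrite /upd; case: (i =P inord r) => [->|/eqP ir].
    by rewrite inordK // eqxx; apply: tape_holds_push; have := tst (inord r); rewrite inordK.
  case: eqP => // ir'; case/eqP: ir; apply: val_inj; by rewrite /= inordK.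
- rewrite /upd; case: (i =P inord r) => [->|/eqP ir].
    rewrite inordK // eqxx.
    by have := tape_holds_pop (tape_holds_keep (tst (inord r))); rewrite inordK.
  case: eqP => // ir'; case/eqP: ir; apply: val_inj; by rewrite /= inordK.
Qed.

Lemma simulates_iter n c C : simulates c C ->
  simulates (iter n prog_step c) (iter (n * 2) (@tm_step prog_machine) C).
Proof.
move=> cC; elim: n => [//|n IHn].
by rewrite mulSn iterD iterS; apply: simulates_step.
Qed.

(** The factor 2 counts two machine steps per program step; register [K] is the last tape, hence the
    output. *)
Lemma prog_machine_outputs x st' n :
  runs p (fun r => if r == 0 then x else [::]) st' n ->
  tm_outputs_within prog_machine (n * 2) x (st' K).
Proof.
case=> m mn /(_ [::]) r.
have init : simulates ([:: p], fun r => if r == 0 then x else [::]) (tm_init prog_machine x).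
  split=> //=; first by rewrite inE mem_conts.
  move=> i; rewrite !ffunE; case: ifPn => [/eqP ->|i0]; exists 0; rewrite /= ?cats0 //.
  by rewrite ifN.
(* The empty continuation is a fixed point of [prog_step], so the run extends from its actual length
   [m] to the bound [n]. *)
have fin : iter n prog_step ([:: p], fun r => if r == 0 then x else [::]) = ([::], st').
  by rewrite -(subnK mn) iterD r; elim: (n - m) => //= i ->.
have := simulates_iter n init; rewrite fin /tm_outputs_within.
case: (iter (n * 2) _ _) => q t [/= _ -> holds].
split; first by rewrite cont_stateK ?mem_head.
have [j] := holds ord_max; rewrite /tape_word => -> /=.
by elim: (st' K) => [|b s /= ->] //=; case: j.
Qed.

End Compile.

(** * Polynomially bounded terms *)

Lemma runs_le p st st' m n : runs p st st' m -> m <= n -> runs p st st' n.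
Proof. by case=> k km r mn; exists k => //; apply: leq_trans km mn. Qed.

Lemma runs_skip st : runs Skip st st 1.
Proof. by exists 1. Qed.

Lemma runs_push r b st : runs (Push r b) st (upd st r (b :: st r)) 1.
Proof. by exists 1. Qed.

Lemma runs_pop r st : runs (Pop r) st (upd st r (behead (st r))) 1.
Proof. by exists 1. Qed.

Lemma runs_seq p q st st1 st2 m n :
  runs p st st1 m -> runs q st1 st2 n -> runs (Seq p q) st st2 (m + n).+1.
Proof.
move=> [i im ri] [j jn rj]; exists (i + j).+1; first by rewrite ltnS leq_add.
by move=> k; rewrite iterSr addnC iterD ri rj.
Qed.

Lemma runs_test r pe pf pt st st' n :
  runs (if ohead (st r) is Some b then if b then pt else pf else pe) st st' n ->
  runs (Test r pe pf pt) st st' n.+1.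
Proof.
by move=> [i im ri]; exists i.+1 => // k; rewrite iterSr -[RHS]ri.
Qed.

Lemma runs_while_end r p st : st r = [::] -> runs (While r p) st st 1.
Proof. by move=> e; exists 1 => // k; rewrite /= /prog_step /= e. Qed.

Lemma runs_while_step r p st st1 st2 b s m n : st r = b :: s ->
  runs p st st1 m -> runs (While r p) st1 st2 n ->
  runs (While r p) st st2 (m + n).+1.
Proof.
move=> e [i im ri] [j jn rj]; exists (i + j).+1; first by rewrite ltnS leq_add.
by move=> k; rewrite iterSr addnC iterD /prog_step /= e ri rj.
Qed.

Ltac upd_cases :=
  let r := fresh "r" in
  apply: functional_extensionality => r; rewrite /upd;
  repeat match goal with |- context [?a == ?b] => case: (@eqP _ a b) => ? end;
  try (exfalso; lia); try subst r; try done.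

(** * Elementary register operations and their linear running times *)

Definition move_reg a b : prog :=
  While a (Test a Skip (Seq (Pop a) (Push b false)) (Seq (Pop a) (Push b true))).

(** Popping destroys [a], so its contents go to two registers at once, both reversed; moving one of
    them back restores [a]. *)
Definition copy_reg a b c : prog :=
  While a (Test a Skip
    (Seq (Pop a) (Seq (Push b false) (Push c false)))
    (Seq (Pop a) (Seq (Push b true) (Push c true)))).

Definition clear_reg a : prog := While a (Pop a).

Lemma runs_move a b st : a != b ->
  runs (move_reg a b) st (upd (upd st b (rev (st a) ++ st b)) a [::])
    (5 * size (st a)).+1.
Proof.
move=> ab; have [s es] : exists s, st a = s by eexists.
rewrite es; elim: s st es => [|x s IHs] st es.
  have -> : upd (upd st b (rev [::] ++ st b)) a [::] = st by upd_cases.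
  exact: runs_while_end.
pose st1 := upd (upd st a s) b (x :: st b).
have e1 : st1 a = s by rewrite /st1 /upd (negbTE ab) eqxx.
have := IHs _ e1.
have -> : upd (upd st1 b (rev s ++ st1 b)) a [::] =
          upd (upd st b (rev (x :: s) ++ st b)) a [::].
  by apply: functional_extensionality => i; rewrite /st1 /upd; case: eqP => // _; case: eqP => // _;
     rewrite eqxx rev_cons cat_rcons.
move=> r; apply: (@runs_le _ _ _ (4 + (5 * size s).+1).+1); last by rewrite /=; lia.
apply: (runs_while_step es _ r).
apply: runs_test; rewrite es /=.
suff : runs (Seq (Pop a) (Push b x)) st st1 3 by case: (x).
have := runs_seq (runs_pop a st) (runs_push b x (upd st a (behead (st a)))).
suff -> : upd (upd st a (behead (st a))) b (x :: upd st a (behead (st a)) b) = st1 by [].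
by rewrite /st1 es /= /upd [b == a]eq_sym (negbTE ab).
Qed.

Lemma runs_copy a b c st : a != b -> a != c -> b != c ->
  runs (copy_reg a b c) st
    (upd (upd (upd st c (rev (st a) ++ st c)) b (rev (st a) ++ st b)) a [::])
    (7 * size (st a)).+1.
Proof.
move=> ab ac bc; have [s es] : exists s, st a = s by eexists.
rewrite es; elim: s st es => [|x s IHs] st es.
  have -> : upd (upd (upd st c (rev [::] ++ st c)) b (rev [::] ++ st b)) a [::] = st
    by upd_cases.
  exact: runs_while_end.
pose st1 := upd (upd (upd st a s) b (x :: st b)) c (x :: st c).
have e1 : st1 a = s by rewrite /st1 /upd (negbTE ab) (negbTE ac) eqxx.
have := IHs _ e1.
have -> : upd (upd (upd st1 c (rev s ++ st1 c)) b (rev s ++ st1 b)) a [::] =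
          upd (upd (upd st c (rev (x :: s) ++ st c)) b (rev (x :: s) ++ st b)) a [::].
  apply: functional_extensionality => i; rewrite /st1 /upd; case: eqP => // _; case: eqP => [_|_].
    by rewrite (negbTE bc) eqxx rev_cons cat_rcons.
  by case: eqP => // _; rewrite eqxx rev_cons cat_rcons.
move=> r; apply: (@runs_le _ _ _ (6 + (7 * size s).+1).+1); last by rewrite /=; lia.
apply: (runs_while_step es _ r).
apply: runs_test; rewrite es /=.
suff : runs (Seq (Pop a) (Seq (Push b x) (Push c x))) st st1 5 by case: (x).
pose st2 := upd st a (behead (st a)).
have := runs_seq (runs_pop a st)
  (runs_seq (runs_push b x st2) (runs_push c x (upd st2 b (x :: st2 b)))).
suff -> : upd (upd st2 b (x :: st2 b)) c (x :: upd st2 b (x :: st2 b) c) = st1 by [].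
rewrite /st1 /st2 es /=; apply: functional_extensionality => i; rewrite /upd.
have ba : b != a by rewrite eq_sym.
have ca : c != a by rewrite eq_sym.
have cb : c != b by rewrite eq_sym.
by rewrite (negbTE ba) (negbTE ca) (negbTE cb).
Qed.

Lemma runs_clear a st :
  runs (clear_reg a) st (upd st a [::]) (2 * size (st a)).+1.
Proof.
have [s es] : exists s, st a = s by eexists.
rewrite es; elim: s st es => [|x s IHs] st es.
  have -> : upd st a [::] = st by upd_cases.
  exact: runs_while_end.
have e1 : upd st a s a = s by rewrite /upd eqxx.
have := IHs _ e1; have -> : upd (upd st a s) a [::] = upd st a [::] by upd_cases.
move=> r; apply: (@runs_le _ _ _ (1 + (2 * size s).+1).+1); last by rewrite /=; lia.
apply: (runs_while_step es _ r).
by have := runs_pop a st; rewrite es.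
Qed.

(* A function language whose values stay polynomially bounded: the only
   iteration, [For], concatenates the results of its body and passes on no
   state. Variables are de Bruijn levels; the loop variable is in unary. *)
Inductive expr :=
| Var of nat
| Const of word
| Cat of expr & expr
| Let of expr & expr
| For of expr & expr
| Case of expr & expr & expr & expr
| Drop of expr & expr.

Fixpoint eval e (env : seq word) : word :=
  match e with
  | Var i => nth [::] env i
  | Const w => w
  | Cat e1 e2 => eval e1 env ++ eval e2 env
  | Let e1 e2 => eval e2 (rcons env (eval e1 env))
  | For e1 e2 =>
      flatten [seq eval e2 (rcons env (nseq i true))
              | i <- iota 0 (size (eval e1 env))]
  | Case e ee ef et =>
      if ohead (eval e env) is Some b then
        if b then eval et env else eval ef env
      else eval ee env
  | Drop e1 e2 => drop (size (eval e1 env)) (eval e2 env)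
  end.

(* Appends the reversed value to register [o]; the registers [rs] hold the
   environment and those from [m] on are scratch space. *)
Fixpoint compile e (rs : seq nat) m o : prog :=
  match e with
  | Var i =>
      if i < size rs then Seq (copy_reg (nth 0 rs i) m o) (move_reg m (nth 0 rs i))
      else Skip
  | Const w => foldr (fun b p => Seq (Push o b) p) Skip w
  | Cat e1 e2 => Seq (compile e1 rs m o) (compile e2 rs m o)
  | Let e1 e2 =>
      Seq (compile e1 rs m.+1 m)
     (Seq (move_reg m m.+1)
     (Seq (compile e2 (rcons rs m.+1) m.+2 o)
          (clear_reg m.+1)))
  | For e1 e2 =>
      Seq (compile e1 rs m.+1 m)
     (Seq (While m (Seq (Pop m)
                   (Seq (compile e2 (rcons rs m.+1) m.+2 o)
                        (Push m.+1 true))))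
          (clear_reg m.+1))
  | Case e ee ef et =>
      Seq (compile e rs m.+1 m)
     (Seq (move_reg m m.+1)
          (Test m.+1 (compile ee rs m o)
            (Seq (clear_reg m.+1) (compile ef rs m o))
            (Seq (clear_reg m.+1) (compile et rs m o))))
  | Drop e1 e2 =>
      Seq (compile e1 rs m.+1 m)
     (Seq (compile e2 rs m.+2 m.+1)
     (Seq (move_reg m.+1 m.+2)
     (Seq (While m (Seq (Pop m) (Pop m.+2)))
          (move_reg m.+2 o))))
  end.

(* Bounds both the length of the value and the running time when all variables
   have length at most [n]. *)
Fixpoint cost e n : nat :=
  match e with
  | Var _ => 12 * n + 4
  | Const w => 2 * size w + 1
  | Cat e1 e2 => cost e1 n + cost e2 n + 1
  | Let e1 e2 => 8 * cost e1 n + cost e2 (n + cost e1 n) + 6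
  | For e1 e2 => cost e1 n * (cost e2 (n + cost e1 n) + 7) + cost e1 n + 6
  | Case e ee ef et => 8 * cost e n + cost ee n + cost ef n + cost et n + 6
  | Drop e1 e2 => 5 * cost e1 n + 11 * cost e2 n + 7
  end.

(** * Polynomial bounds on cost and on the size of values *)

Definition poly_bounded (f : nat -> nat) :=
  exists p : {poly nat}, forall n, f n <= p.[n]%R.

Lemma leq_horner (p : {poly nat}) m n : m <= n -> p.[m]%R <= p.[n]%R.
Proof.
move=> mn; rewrite !horner_coef; elim/big_ind2: _ => //.
  by move=> a b c d; apply: leq_add.
move=> i _; rewrite !natrE leq_mul //.
by case: (nat_of_ord i) => // k; rewrite leq_exp2r.
Qed.

Lemma poly_bounded_const c : poly_bounded (fun=> c).
Proof. by exists c%:P%R => n; rewrite hornerC. Qed.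

Lemma poly_bounded_id : poly_bounded id.
Proof. by exists 'X%R => n; rewrite hornerX. Qed.

Lemma poly_boundedD f g :
  poly_bounded f -> poly_bounded g -> poly_bounded (fun n => f n + g n).
Proof. by move=> [p pf] [q qg]; exists (p + q)%R => n; rewrite hornerD leq_add. Qed.

Lemma poly_boundedM f g :
  poly_bounded f -> poly_bounded g -> poly_bounded (fun n => f n * g n).
Proof. by move=> [p pf] [q qg]; exists (p * q)%R => n; rewrite hornerM leq_mul. Qed.

(** Only the bounding polynomial has to be monotone, which its natural coefficients ensure; [f]
    itself may be arbitrary below it. *)
Lemma poly_bounded_comp f g :
  poly_bounded f -> poly_bounded g -> poly_bounded (fun n => f (g n)).
Proof.
move=> [p pf] [q qg]; exists (p \Po q)%R => n; rewrite horner_comp.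
exact: leq_trans (pf _) (leq_horner _ (qg n)).
Qed.

Lemma poly_bounded_cost e : poly_bounded (cost e).
Proof.
elim: e => [i|w|e1 IH1 e2 IH2|e1 IH1 e2 IH2|e1 IH1 e2 IH2
   |e IH e1 IH1 e2 IH2 e3 IH3|e1 IH1 e2 IH2] /=;
  repeat first [exact: poly_bounded_const | exact: poly_bounded_id | assumption
    | apply: poly_boundedD | apply: poly_boundedM
    | apply: (poly_bounded_comp (f := cost e2))].
Qed.

Lemma size_eval e env n :
  all (fun w => size w <= n) env -> size (eval e env) <= cost e n.
Proof.
elim: e env n => [i|w|e1 IH1 e2 IH2|e1 IH1 e2 IH2|e1 IH1 e2 IH2
   |e IH e1 IH1 e2 IH2 e3 IH3|e1 IH1 e2 IH2] env n env_n /=.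
- have [i_env|i_env] := ltnP i (size env); last by rewrite nth_default.
  by have /= := allP env_n _ (mem_nth [::] i_env); lia.
- lia.
- by rewrite size_cat; have := IH1 _ _ env_n; have := IH2 _ _ env_n; lia.
- have h1 := IH1 _ _ env_n.
  apply: (@leq_trans (cost e2 (n + cost e1 n))); last by lia.
  apply: IH2; rewrite all_rcons; apply/andP; split; first by lia.
  by apply: sub_all env_n => w /=; lia.
- have h1 := IH1 _ _ env_n.
  set c := cost e2 _.
  apply: (@leq_trans (size (eval e1 env) * c)); last by nia.
  (* The unary loop index is shorter than the value of [e1], so [n + cost e1 n] bounds every entry
     of the extended environment. *)
  have : {in iota 0 (size (eval e1 env)), forall i, size (eval e2 (rcons env (nseq i true))) <= c}.
    move=> i; rewrite mem_iota add0n => /andP[_ i_lt].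
    apply: IH2; rewrite all_rcons size_nseq; apply/andP; split; first by lia.
    by apply: sub_all env_n => w /=; lia.
  rewrite -{3}(size_iota 0 (size (eval e1 env))).
  elim: (iota _ _) => //= i s IHs ic; rewrite size_cat mulSn leq_add //.
    by apply: ic; rewrite mem_head.
  by apply: IHs => j js; apply: ic; rewrite inE js orbT.
- have := IH1 _ _ env_n; have := IH2 _ _ env_n; have := IH3 _ _ env_n.
  by case: ohead => [[]|]; lia.
- by rewrite size_drop; have := IH2 _ _ env_n; lia.
Qed.

(** * Correctness and running time of compiled terms *)

Definition store_ok rs m env (st : store) :=
  [/\ size rs = size env,
      forall i, i < size rs -> st (nth 0 rs i) = nth [::] env i,
      all (fun r => r < m) rs
    & forall r, m <= r -> st r = [::]].

Lemma store_ok_le rs m m' env st :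
  m <= m' -> store_ok rs m env st -> store_ok rs m' env st.
Proof.
move=> mm [h1 h2 h3 h4]; split=> //; first by apply: sub_all h3 => r /=; lia.
by move=> r mr; apply: h4; lia.
Qed.

(** Lets the accumulator [o] change freely: it lies below the scratch space and holds no
    variable. *)
Lemma store_ok_out rs m env st o w : o < m -> o \notin rs ->
  store_ok rs m env st -> store_ok rs m env (upd st o w).
Proof.
move=> om ors [h1 h2 h3 h4]; split=> //.
- move=> i irs; rewrite /upd; case: eqP => [e|_]; last exact: h2.
  by case/negP: ors; rewrite -e mem_nth.
- by move=> r mr; rewrite /upd; case: eqP => [e|_]; [lia|exact: h4].
Qed.

Lemma store_ok_fresh rs m env st : store_ok rs m env st -> m \notin rs.
Proof. by case=> _ _ /allP h _; apply/negP => /h; rewrite ltnn. Qed.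

Lemma store_ok_scratch rs m env st w :
  store_ok rs m env st -> store_ok rs m.+1 env (upd st m w).
Proof.
move=> ok; apply: store_ok_out => //; first exact: store_ok_fresh ok.
exact: store_ok_le ok.
Qed.

Lemma store_ok_bind rs m env st w : store_ok rs m env st ->
  store_ok (rcons rs m) m.+1 (rcons env w) (upd st m w).
Proof.
move=> ok; have [h1 h2 h3 h4] := store_ok_scratch w ok; split=> //.
- by rewrite !size_rcons h1.
- move=> i; rewrite size_rcons !nth_rcons -h1 ltnS leq_eqVlt => /orP[/eqP ->|irs].
    by rewrite ltnn eqxx /upd eqxx.
  by rewrite irs; apply: h2.
- by rewrite all_rcons ltnSn.
Qed.

(** The loop invariant is the store [F i s a]: the length of [s] in [m] counts the remaining rounds,
    [m.+1] holds the index [i] in unary, and [o] holds the reversed output so far. *)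
Lemma runs_For_loop rs m o env st body i s a n c :
  store_ok rs m env st -> o < m -> o \notin rs ->
  (forall i st', i <= n -> store_ok (rcons rs m.+1) m.+2 (rcons env (nseq i true)) st' ->
     runs (compile body (rcons rs m.+1) m.+2 o) st'
       (upd st' o (rev (eval body (rcons env (nseq i true))) ++ st' o)) c) ->
  i + size s <= n ->
  let F i s a := upd (upd (upd st o a) m s) m.+1 (nseq i true) in
  runs (While m (Seq (Pop m) (Seq (compile body (rcons rs m.+1) m.+2 o) (Push m.+1 true))))
    (F i s a)
    (F (i + size s) [::]
       (rev (flatten [seq eval body (rcons env (nseq j true)) | j <- iota i (size s)]) ++ a))
    (size s * (c + 5)).+1.
Proof.
move=> ok om ors runs_body + F; elim: s i a => [|b s IHs] i a i_n.
  rewrite addn0; apply: runs_while_end; rewrite /F /upd.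
  by case: eqP => [|_]; [lia|rewrite eqxx].
rewrite /= rev_cat -catA.
have /= := IHs i.+1 (rev (eval body (rcons env (nseq i true))) ++ a).
rewrite addSnnS => /(_ i_n) r.
apply: (@runs_le _ _ _ ((1 + (c + 1).+1).+1 + (size s * (c + 5)).+1).+1); last by lia.
apply: (runs_while_step (b := b) (s := s) _ _ r).
  by rewrite /F /upd; case: eqP => [|_]; [lia|rewrite eqxx].
have e1 : upd (F i (b :: s) a) m (behead (F i (b :: s) a m)) = F i s a.
  by rewrite /F; upd_cases.
apply: runs_seq; first exact: runs_pop.
rewrite e1; apply: runs_seq.
  apply: runs_body; first by apply: leq_trans i_n; apply: leq_addr.
  apply: store_ok_bind; apply: store_ok_scratch; exact: store_ok_out.
set st1 := upd _ _ _.
have -> : F i.+1 s (rev (eval body (rcons env (nseq i true))) ++ a) =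
    upd st1 m.+1 (true :: st1 m.+1).
  by rewrite /st1 /F; upd_cases.
exact: runs_push.
Qed.

Lemma runs_Drop_loop a b st : a != b ->
  runs (While a (Seq (Pop a) (Pop b))) st
    (upd (upd st b (drop (size (st a)) (st b))) a [::]) (4 * size (st a)).+1.
Proof.
move=> ab; have [s es] : exists s, st a = s by eexists.
rewrite es; elim: s st es => [|x s IHs] st es.
  have -> : upd (upd st b (drop (size (Nil bool)) (st b))) a [::] = st.
    by rewrite drop0; upd_cases.
  exact: runs_while_end.
pose st1 := upd (upd st a s) b (behead (st b)).
have e1 : st1 a = s by rewrite /st1 /upd (negbTE ab) eqxx.
have := IHs _ e1.
have -> : upd (upd st1 b (drop (size s) (st1 b))) a [::] =
          upd (upd st b (drop (size (x :: s)) (st b))) a [::].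
  rewrite /st1; upd_cases; by case: (st b).
move=> r; apply: (@runs_le _ _ _ (3 + (4 * size s).+1).+1); last by rewrite /=; lia.
apply: (runs_while_step es _ r).
have := runs_seq (runs_pop a st) (runs_pop b (upd st a (behead (st a)))).
suff -> : upd (upd st a (behead (st a))) b (behead (upd st a (behead (st a)) b)) = st1 by [].
by rewrite /st1 es /= /upd [b == a]eq_sym (negbTE ab).
Qed.

Lemma runs_eq p st st1 st2 n : runs p st st1 n -> st1 = st2 -> runs p st st2 n.
Proof. by move=> r <-. Qed.

(** Bits are pushed one at a time, so a value arrives reversed on top of [o], and [Cat] becomes
    plain sequencing. Where the order of an intermediate value matters, a [move_reg] restores it;
    counters stay reversed, as only their length is used. *)
Lemma compile_runs e rs m o env st n :
  store_ok rs m env st -> o < m -> o \notin rs ->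
  all (fun w => size w <= n) env ->
  runs (compile e rs m o) st (upd st o (rev (eval e env) ++ st o)) (cost e n).
Proof.
elim: e rs m o env st n => [i|w|e1 IH1 e2 IH2|e1 IH1 e2 IH2|e1 IH1 e2 IH2
   |e IH e1 IH1 e2 IH2 e3 IH3|e1 IH1 e2 IH2] rs m o env st n ok om ors env_n /=.
- have [rs_env st_rs rs_m st_m] := ok.
  case: ltnP => i_rs; last first.
    rewrite nth_default -?rs_env //; apply: (@runs_le _ _ _ 1); last by lia.
    by apply: runs_eq (runs_skip _) _; upd_cases.
  set a := nth 0 rs i.
  have a_in : a \in rs by rewrite mem_nth.
  have am : a < m := allP rs_m _ a_in.
  have ao : a != o by apply: contraNneq ors => <-.
  have sa : st a = nth [::] env i by rewrite st_rs.
  have sz : size (st a) <= n.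
    by rewrite sa; apply: (allP env_n); rewrite mem_nth // -rs_env.
  have stm : st m = [::] by rewrite st_m.
  have r1 := @runs_copy a m o st _ ao _.
  have {}r1 := r1 _ _; rewrite -sa.
  pose st1 := upd (upd (upd st o (rev (st a) ++ st o)) m (rev (st a) ++ st m)) a [::].
  have ma : m != a by lia.
  have st1m : st1 m = rev (st a).
    by rewrite /st1 /upd (negbTE ma) eqxx stm cats0.
  have r2 := runs_move st1 ma; rewrite st1m size_rev revK in r2.
  apply: (@runs_le _ _ _ ((7 * size (st a)).+1 + (5 * size (st a)).+1).+1); last by lia.
  apply: (runs_seq (st1 := st1)); first by apply: r1; lia.
  apply: runs_eq r2 _; rewrite /st1; upd_cases; by rewrite ?cats0 ?stm.
- elim: w st {ok} => [|b w IHw] st /=.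
    by apply: runs_eq (runs_le (runs_skip _) _) _ => //; upd_cases.
  apply: (@runs_le _ _ _ (1 + (2 * size w + 1)).+1); last by lia.
  apply: runs_seq (runs_push _ _ _) _.
  apply: runs_eq (IHw _) _; rewrite rev_cons cat_rcons; upd_cases.
- have r1 := IH1 _ _ _ _ _ _ ok om ors env_n.
  have r2 := IH2 _ _ _ _ _ _ (store_ok_out (rev (eval e1 env) ++ st o) om ors ok) om ors env_n.
  apply: (@runs_le _ _ _ (cost e1 n + cost e2 n).+1); last by lia.
  apply: runs_seq r1 _; apply: runs_eq r2 _.
  by rewrite rev_cat -catA; upd_cases.
- have stm r : m <= r -> st r = [::] by case: ok => _ _ _; apply.
  have r1 := IH1 _ m.+1 m _ _ _ (store_ok_le (leqnSn m) ok)
    (ltnSn m) (store_ok_fresh ok) env_n.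
  have sz := size_eval e1 env_n.
  set v := eval e1 env in r1 sz *.
  rewrite (stm m) // cats0 in r1.
  have mm : m != m.+1 by lia.
  have r2 := runs_move (upd st m (rev v)) mm.
  have e1' : upd st m (rev v) m = rev v by rewrite /upd eqxx.
  have e2' : upd st m (rev v) m.+1 = [::] by rewrite /upd eq_sym (negbTE mm) stm.
  rewrite e1' e2' size_rev revK cats0 in r2.
  have {}r2 := runs_eq r2 (_ : _ = upd st m.+1 v).
  have {}r2 := r2 _.
  have ok2 := store_ok_bind v (store_ok_le (leqnSn m) ok).
  have r3 := IH2 _ m.+2 o _ _ (n + cost e1 n) ok2 _ _ _.
  have r4 := runs_clear m.+1 (upd (upd st m.+1 v) o (rev (eval e2 (rcons env v)) ++ st o)).
  have e3 : upd (upd st m.+1 v) o (rev (eval e2 (rcons env v)) ++ st o) m.+1 = v.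
    by rewrite /upd eqxx; case: eqP => // ?; lia.
  rewrite e3 in r4.
  apply: (@runs_le _ _ _ (cost e1 n + ((5 * size v).+1 +
    (cost e2 (n + cost e1 n) + (2 * size v).+1).+1).+1).+1); last by lia.
  apply: runs_seq r1 _; apply: runs_seq.
    by apply: r2; upd_cases; rewrite stm.
  apply: runs_seq.
    apply: runs_eq (r3 _ _ _) _; first by lia.
    + rewrite mem_rcons inE negb_or ors andbT; lia.
    + rewrite all_rcons; apply/andP; split; first by lia.
      by apply: sub_all env_n => w /=; lia.
    + have -> : upd st m.+1 v o = st o by rewrite /upd; case: eqP => // ?; lia.
      by [].
  by apply: runs_eq r4 _; upd_cases; rewrite stm.
- have stm r : m <= r -> st r = [::] by case: ok => _ _ _; apply.
  have r1 := IH1 _ m.+1 m _ _ _ (store_ok_le (leqnSn m) ok)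
    (ltnSn m) (store_ok_fresh ok) env_n.
  have sz := size_eval e1 env_n.
  set v := eval e1 env in r1 sz *.
  rewrite (stm m) // cats0 in r1.
  set c := cost e2 _.
  have body i st' : i <= size v -> store_ok (rcons rs m.+1) m.+2 (rcons env (nseq i true)) st' ->
     runs (compile e2 (rcons rs m.+1) m.+2 o) st'
       (upd st' o (rev (eval e2 (rcons env (nseq i true))) ++ st' o)) c.
    move=> iv ok'; apply: IH2 => //; first by lia.
      rewrite mem_rcons inE negb_or ors andbT; lia.
    rewrite all_rcons size_nseq; apply/andP; split; first by lia.
    by apply: sub_all env_n => w /=; lia.
  have := @runs_For_loop _ _ _ _ _ e2 0 (rev v) (st o) _ c ok om ors body.
  rewrite size_rev leqnn add0n => /(_ isT) /= r2.
  set res := flatten _ in r2 *.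
  apply: (@runs_le _ _ _ (cost e1 n +
    ((size v * (c + 5)).+1 + (2 * size v).+1).+1).+1); last by nia.
  apply: runs_seq r1 _; apply: runs_seq.
    have -> : upd st m (rev v) = upd (upd (upd st o (st o)) m (rev v)) m.+1 [::].
      by upd_cases; rewrite stm.
    exact: r2.
  set st2 := upd _ m.+1 _.
  have e3 : st2 m.+1 = nseq (size v) true by rewrite /st2 /upd eqxx.
  have r3 := runs_clear m.+1 st2; rewrite e3 size_nseq in r3.
  by apply: runs_eq r3 _; rewrite /st2; upd_cases; rewrite stm.
- have stm r : m <= r -> st r = [::] by case: ok => _ _ _; apply.
  have r0 := IH _ m.+1 m _ _ _ (store_ok_le (leqnSn m) ok)
    (ltnSn m) (store_ok_fresh ok) env_n.
  have sz := size_eval e env_n.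
  set v := eval e env in r0 sz *.
  rewrite (stm m) // cats0 in r0.
  have mm : m != m.+1 by lia.
  have r2 := runs_move (upd st m (rev v)) mm.
  have e1' : upd st m (rev v) m = rev v by rewrite /upd eqxx.
  have e2' : upd st m (rev v) m.+1 = [::] by rewrite /upd eq_sym (negbTE mm) stm.
  rewrite e1' e2' size_rev revK cats0 in r2.
  have {}r2 := runs_eq r2 (_ : _ = upd st m.+1 v).
  have {}r2 := r2 _.
  have r3 := runs_clear m.+1 (upd st m.+1 v).
  have ev1 : upd st m.+1 v m.+1 = v by rewrite /upd eqxx.
  have ev2 : upd (upd st m.+1 v) m.+1 [::] = st by upd_cases; rewrite stm.
  rewrite ev1 ev2 in r3.
  have k1 := IH1 _ _ _ _ _ _ ok om ors env_n.
  have k2 := IH2 _ _ _ _ _ _ ok om ors env_n.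
  have k3 := IH3 _ _ _ _ _ _ ok om ors env_n.
  (* A common time bound for the three branches, including the clearing of the scrutinee. *)
  pose c := (2 * size v).+1 + cost e1 n + cost e2 n + cost e3 n.
  apply: (@runs_le _ _ _ (cost e n + ((5 * size v).+1 + c.+2).+1).+1); last by rewrite /c; lia.
  apply: runs_seq r0 _; apply: runs_seq.
    by apply: r2; upd_cases; rewrite stm.
  apply: runs_test; rewrite ev1; case ev: v => [|[] s] /=.
  + have -> : upd st m.+1 [::] = st by upd_cases; rewrite stm.
    by apply: runs_le k1 _; rewrite /c; lia.
  + rewrite -ev; apply: runs_le (runs_seq r3 k3) _; rewrite /c; lia.
  + rewrite -ev; apply: runs_le (runs_seq r3 k2) _; rewrite /c; lia.
- have stm r : m <= r -> st r = [::] by case: ok => _ _ _; apply.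
  have r1 := IH1 _ m.+1 m _ _ _ (store_ok_le (leqnSn m) ok)
    (ltnSn m) (store_ok_fresh ok) env_n.
  have sz1 := size_eval e1 env_n.
  have sz2 := size_eval e2 env_n.
  set v := eval e1 env in r1 sz1 *.
  rewrite (stm m) // cats0 in r1.
  have ok1 := store_ok_scratch (rev v) ok.
  have r2 := IH2 _ m.+2 m.+1 _ _ _ (store_ok_le (leqnSn _) ok1)
    (ltnSn _) (store_ok_fresh ok1) env_n.
  set w := eval e2 env in r2 sz2 *.
  have e1' : upd st m (rev v) m.+1 = [::] by rewrite /upd ifN ?stm //; lia.
  rewrite e1' cats0 in r2.
  pose st2 := upd (upd st m (rev v)) m.+1 (rev w).
  have mm : m.+1 != m.+2 by lia.
  have r3 := runs_move st2 mm.
  have s21 : st2 m.+1 = rev w by rewrite /st2 /upd eqxx.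
  have s22 : st2 m.+2 = [::] by rewrite /st2 /upd !ifN ?stm //; lia.
  rewrite s21 s22 revK cats0 size_rev in r3.
  pose st3 := upd (upd st m (rev v)) m.+2 w.
  have mm' : m != m.+2 by lia.
  have r4 := runs_Drop_loop st3 mm'.
  have s31 : st3 m = rev v by rewrite /st3 /upd ifN ?eqxx //; lia.
  have s32 : st3 m.+2 = w by rewrite /st3 /upd eqxx.
  rewrite s31 s32 size_rev in r4.
  pose st4 := upd st m.+2 (drop (size v) w).
  have mo : m.+2 != o by lia.
  have r5 := runs_move st4 mo.
  have s41 : st4 m.+2 = drop (size v) w by rewrite /st4 /upd eqxx.
  have s42 : st4 o = st o by rewrite /st4 /upd ifN //; lia.
  rewrite s41 s42 size_drop in r5.
  apply: (@runs_le _ _ _ (cost e1 n + (cost e2 n + ((5 * size w).+1 +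
     ((4 * size v).+1 + (5 * (size w - size v)).+1).+1).+1).+1).+1); last by lia.
  apply: runs_seq r1 _; apply: runs_seq r2 _; apply: (runs_seq (st1 := st3)).
    by apply: runs_eq r3 _; rewrite /st2 /st3; upd_cases; rewrite stm.
  apply: (runs_seq (st1 := st4)).
    by apply: runs_eq r4 _; rewrite /st3 /st4; upd_cases; rewrite stm.
  by apply: runs_eq r5 _; rewrite /st4; upd_cases; rewrite stm //; lia.
Qed.

Theorem polytime_expr e : polytime_function (fun x => eval e [:: x]).
Proof.
pose p0 := compile e [:: 0] 2 1.
(* The output tape must be the last one: the result is moved from register 1 to a fresh register
   above all others, which also undoes the reversal. *)
pose K := (maxn 1 (max_reg p0)).+1.
pose p := Seq p0 (move_reg 1 K).
have [P hP] := poly_bounded_cost e.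
(* With [P] bounding both time and size, the term takes [P] steps, the final move [5P + 1] and the
   sequencing one more; each costs two machine steps. *)
exists (prog_machine p K), ((P * 6%:P + 2%:P) * 2%:P)%R => x.
have pK : max_reg p <= K by rewrite /p /K /=; lia.
pose st0 : store := fun r => if r == 0 then x else [::].
have ok : store_ok [:: 0] 2 [:: x] st0.
  by split=> // [[]|[|]] //.
have r1 := @compile_runs e [:: 0] 2 1 [:: x] st0 (size x) ok isT isT.
rewrite /= leqnn in r1; have {r1} := r1 isT.
rewrite /st0 /= cats0 -/st0 => r1.
set st1 := upd _ _ _ in r1.
have K1 : 1 != K by rewrite /K; lia.
have r2 := runs_move st1 K1.
have s1 : st1 1 = rev (eval e [:: x]) by rewrite /st1 /upd eqxx.
have sK : st1 K = [::] by rewrite /st1 /upd eq_sym (negbTE K1) /st0.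
rewrite s1 sK cats0 revK size_rev in r2.
have sz : size (eval e [:: x]) <= cost e (size x) by apply: size_eval; rewrite /= leqnn.
rewrite hornerM hornerD hornerM !hornerC.
pose st2 := upd (upd st1 K (eval e [:: x])) 1 [::].
have r : runs p st0 st2 (P.[size x]%R * 6 + 2).
  by apply: runs_le (runs_seq r1 r2) _; have := hP (size x); lia.
have := prog_machine_outputs pK r.
by rewrite /st2 /upd [K == 1]eq_sym (negbTE K1) eqxx.
Qed.

(** * Team formation on complete signed graphs *)

Section CompleteInstance.

Variables (A B : eqType) (nodes : seq A) (vars : seq B).
Variables (R : rel A) (sk : A -> B -> bool).
Hypotheses (nodes_uniq : uniq nodes) (R_sym : symmetric R).

Let n := size nodes.
Let m := size vars.
Let node (u : 'I_n) : A := tnth (in_tuple nodes) u.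
Let var (s : 'I_m) : B := tnth (in_tuple vars) s.

Definition complete_edges : {set 'I_n * 'I_n * bool} :=
  [set e | (e.1.1 != e.1.2) && (e.2 == R (node e.1.1) (node e.1.2))].

Lemma complete_edges_axiom :
  [&& loopless complete_edges, undirected complete_edges,
      simply_signed complete_edges & graph_connected complete_edges].
Proof.
apply/and4P; split.
- by apply/forallP=> u; apply/forallP=> l; rewrite inE eqxx.
- apply/forallP=> u; apply/forallP=> v; apply/forallP=> l.
  by rewrite !inE /= [v == u]eq_sym [R (node v) _]R_sym.
- apply/forallP=> u; apply/forallP=> v; rewrite !inE /=.
  by case: (R _ _); rewrite ?andbF.
- apply/forallP=> u; apply/forallP=> v; have [->|uv] := eqVneq u v.
    exact: connect0.
  apply/connect1/existsP; exists (R (node u) (node v)).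
  by rewrite inE /= uv eqxx.
Qed.

Definition complete_instance : tfsnc_instance :=
  @TfsncInstance n m (ConnectedSignedGraph complete_edges_axiom)
    [ffun u => [set s | sk (node u) (var s)]] setT.

Lemma node_inj : injective node.
Proof. by move=> u v /eqP; rewrite /node !(tnth_nth (node u)) nth_uniq // => /eqP /val_inj. Qed.

Lemma map_enum_tnth (T : eqType) (s : seq T) :
  [seq tnth (in_tuple s) i | i <- enum 'I_(size s)] = s.
Proof. exact: (map_tnth_enum (in_tuple s)). Qed.

(** Expresses the bit tables through the lists [nodes] and [vars] alone, a shape that nested loops
    can print. *)
Lemma encode_complete_instance :
  tfsnc_encode complete_instance =
  nseq (size nodes) true ++ false :: nseq (size vars) true ++ false ::
  flatten [seq [:: (a != b) && R a b; (a != b) && ~~ R a b] | a <- nodes, b <- nodes] ++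
  [seq sk a s | a <- nodes, s <- vars] ++ nseq (size vars) true.
Proof.
rewrite /tfsnc_encode /=; congr (_ ++ _ :: _ ++ _ :: _ ++ _ ++ _).
- congr flatten; rewrite -[in RHS](map_enum_tnth nodes) allpairs_mapl allpairs_mapr.
  apply: eq_allpairs => // u v; rewrite !inE /= -/(node u) -/(node v).
  by rewrite (inj_eq node_inj); case: (R _ _).
- rewrite -[in RHS](map_enum_tnth nodes) -[in RHS](map_enum_tnth vars) allpairs_mapl allpairs_mapr.
  by apply: eq_allpairs => // u v; rewrite ffunE inE.
- rewrite -[in RHS](size_enum_ord (size vars)); elim: (enum _) => //= s l ->.
  by rewrite inE.
Qed.

(** Any two distinct nodes are joined by an edge whose sign is [R], so the edge conditions determine
    [Comp] off the diagonal and reflexivity determines it on the diagonal. *)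
Lemma complete_instance_yes (Comp : compatibility_rule) :
  (forall (V : finType) (G : connected_signed_graph V) (u : V), Comp V G u u) ->
  (forall (V : finType) (G : connected_signed_graph V) (u v : V),
     (u, v, true) \in edges G -> Comp V G u v) ->
  (forall (V : finType) (G : connected_signed_graph V) (u v : V),
     (u, v, false) \in edges G -> ~ Comp V G u v) ->
  tfsnc_yes Comp complete_instance <->
  exists X : pred A,
    {in vars, forall s, exists2 a, a \in nodes & X a && sk a s} /\
    {in nodes &, forall a b, X a -> X b -> a != b -> R a b}.
Proof.
move=> Crefl Cpos Cneg; split.
- case=> /= X [cov comp].
  exists (fun a => [exists u in X, node u == a]); split.
    move=> s s_in; have [i es] : exists i : 'I_m, var i = s.
      by have /tnthP[i ->] : s \in in_tuple vars by []; exists i.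
    have /(subsetP cov) /bigcupP[u uX] : i \in [set: 'I_m] by rewrite inE.
    rewrite ffunE inE es => sk_us; exists (node u); first exact: mem_tnth.
    by rewrite sk_us andbT; apply/existsP; exists u; rewrite uX /=.
  move=> a b _ _ /existsP[u /andP[uX /eqP <-]] /existsP[v /andP[vX /eqP <-]].
  rewrite (inj_eq node_inj) => uv; apply/negPn/negP => nR.
  by apply: (Cneg _ _ _ _ _ (comp u v uX vX)); rewrite inE /= uv /= eq_sym eqbF_neg.
- case=> X [cov comp]; exists [set u | X (node u)]; split.
    apply/subsetP=> s _.
    have [a a_in /andP[Xa sk_a]] := cov (var s) (mem_tnth _ _).
    have [u eu] : exists u : 'I_n, node u = a.
      by have /tnthP[i ->] : a \in in_tuple nodes by []; exists i.
    by apply/bigcupP; exists u; rewrite ?ffunE inE eu.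
  move=> u v; rewrite !inE => Xu Xv; have [->|uv] := eqVneq u v; first exact: Crefl.
  apply: Cpos; rewrite inE /= uv /= eq_sym eqb_id.
  by apply: comp => //; rewrite ?mem_tnth ?(inj_eq node_inj).
Qed.

End CompleteInstance.

(** * Computation tableaux *)

Section Tableau.

Variable M : turing_machine.

Local Notation vec := {ffun 'I_(tm_tapes M).+1 -> cell (tm_aux M)}.

(* A local view of a configuration from one offset relative to the heads: the
   state, the scanned symbols, the contents at the offset and at its two
   neighbours, and which of those three offsets is the head position. *)
Definition view : finType :=
  (tm_state M * vec * (vec * vec * vec) * (bool * bool * bool))%type.

Definition view_state (d : view) := d.1.1.1.
Definition view_scan (d : view) : vec := d.1.1.2.
Definition view_prev (d : view) : vec := d.1.2.1.1.
Definition view_here (d : view) : vec := d.1.2.1.2.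
Definition view_next (d : view) : vec := d.1.2.2.
Definition view_heads (d : view) := d.2.

(** [Negz n] is the offset [-(n + 1)], which fits the nearest-first order of [tape_left]. *)
Definition cell_at (t : tape (tm_aux M)) (o : int) : cell (tm_aux M) :=
  match o with
  | Posz n => nth None (tape_right t) n
  | Negz n => nth None (tape_left t) n
  end.

Definition vec_at (t : {ffun 'I_(tm_tapes M).+1 -> tape (tm_aux M)}) o : vec :=
  [ffun i => cell_at (t i) o].

Lemma vec_atE t o i : vec_at t o i = cell_at (t i) o.
Proof. by rewrite ffunE. Qed.

Definition view_of (c : config M) (o : int) : view :=
  (c.1, vec_at c.2 0%R,
   (vec_at c.2 (o - 1)%R, vec_at c.2 o, vec_at c.2 (o + 1)%R),
   ((o - 1)%R == 0%R, o == 0%R, (o + 1)%R == 0%R)).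

(** Offsets follow the heads, so a head move shifts the contents of its tape by one the other way;
    the flags tell whether the cell arriving here is the one just written. This keeps the rule local
    although the tapes have independent heads. *)
Definition view_step (d : view) : tm_state M * vec :=
  if tm_halted (view_state d) then (view_state d, view_here d) else
  let: (q, w, dir) := tm_trans (view_state d) (view_scan d) in
  (q, [ffun i => match dir i with
                 | MoveLeft => if (view_heads d).1.1 then w i else view_prev d i
                 | Stay => if (view_heads d).1.2 then w i else view_here d i
                 | MoveRight => if (view_heads d).2 then w i else view_next d i
                 end]).

Local Arguments tape_move : simpl never.

Lemma cell_at_write c t o :
  cell_at (tape_write c t) o = if o == 0%R then c else cell_at t o.
Proof. by case: t => l r; case: o => [[|o]|o] //=; rewrite nth_behead. Qed.

Lemma cell_at_move d t o :
  cell_at (tape_move d t) o =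
  cell_at t (match d with MoveLeft => o - 1 | Stay => o | MoveRight => o + 1 end)%R.
Proof.
case: t => l r; rewrite /tape_move; case: d => //.
- case: o => [[|o]|o].
  + have -> : (Posz 0 - 1)%R = Negz 0 by lia. 
    by rewrite /= nth0.
  + by have -> : (Posz o.+1 - 1)%R = Posz o by lia.
  + have -> : (Negz o - 1)%R = Negz o.+1 by lia.
    by rewrite /= nth_behead.
- case: o => [o|[|o]].
  + have -> : (Posz o + 1)%R = Posz o.+1 by lia.
    by rewrite /= nth_behead.
  + have -> : (Negz 0 + 1)%R = Posz 0 by lia.
    by rewrite /= nth0.
  + by have -> : (Negz o.+1 + 1)%R = Negz o by lia.
Qed.

Lemma view_step_of c o :
  view_step (view_of c o) = ((tm_step c).1, vec_at (tm_step c).2 o).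
Proof.
case: c => q t; rewrite /view_step /view_of /view_state /view_scan /=.
case: ifP => // _.
have -> : vec_at t 0%R = [ffun i => tape_read (t i)].
  by apply/ffunP=> i; rewrite !ffunE /= nth0.
case: (tm_trans _ _) => [[q' w] dir] /=; congr pair.
apply/ffunP=> i; rewrite vec_atE !ffunE cell_at_move cell_at_write.
by case: (dir i); rewrite /view_heads /view_prev /view_here /view_next /= ?vec_atE.
Qed.

Definition hor_ok (d e : view) :=
  [&& view_state d == view_state e, view_scan d == view_scan e,
      view_here d == view_prev e & view_next d == view_here e].

Definition ver_ok (d e : view) := (view_state e, view_here e) == view_step d.

Lemma hor_ok_of c o : hor_ok (view_of c o) (view_of c (o + 1)%R).
Proof.
rewrite /hor_ok /view_of /=; apply/and4P; split=> //=.
by have -> : (o + 1 - 1)%R = o by lia.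
Qed.

Lemma ver_ok_of c o : ver_ok (view_of c o) (view_of (tm_step c) o).
Proof. by rewrite /ver_ok view_step_of. Qed.

(** Each constraint is stated in both directions, since the graph is undirected. Two values of the
    same variable do not conflict: a team may contain several, and any choice among its legal ones
    will do. *)
Definition compatible (a b : nat * nat * view) : bool :=
  let: (t, j, d) := a in let: (t', j', d') := b in
  [&& ((t == t') && (j' == j.+1)) ==> hor_ok d d',
      ((t == t') && (j == j'.+1)) ==> hor_ok d' d,
      ((j == j') && (t' == t.+1)) ==> ver_ok d d'
    & ((j == j') && (t == t'.+1)) ==> ver_ok d' d].

Lemma compatible_sym : symmetric compatible.
Proof.
move=> [[t j] d] [[t' j'] d'] /=; rewrite [t' == t]eq_sym [j' == j]eq_sym.
by rewrite !andbA [X in X && _ && _]andbC -!andbA; congr (_ && (_ && _)); rewrite andbC.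
Qed.

(* The input tape holds the known prefix [pw], then a guessed word that ends
   before offset [G]; column [W] is the head position. *)
Variables (pw : word) (G T W : nat).

(** In the guess zone a blank must be followed by a blank, which forces the zone to hold a word
    padded with blanks. *)
Definition input_ok j (d : view) :=
  if j < W then view_here d ord0 == None else
  if ohead (drop (j - W) pw) is Some b then view_here d ord0 == Some (inl b)
  else if j - W < G then
    [|| view_here d ord0 == Some (inl true), view_here d ord0 == Some (inl false)
      | (view_here d ord0 == None) && (view_next d ord0 == None)]
  else view_here d ord0 == None.

Definition start_ok (d : view) :=
  (view_state d == tm_start M) &&
  [forall i, (i != ord0) ==> (view_here d i == None)].

(** These are the unary constraints; column [j] has offset [j - W]. Acceptance looks only at the
    first output bit, which separates [[:: true]] from [[:: false]]. *)
Definition legal t j (d : view) :=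
  [&& (view_heads d).1.1 == (j == W.+1), (view_heads d).1.2 == (j == W),
      (view_heads d).2 == (j.+1 == W),
      (view_heads d).1.2 ==> (view_scan d == view_here d),
      (t == 0) ==> start_ok d && input_ok j d
    & (t == T) ==> (view_scan d ord_max == Some (inl true))].

Definition run y t : config M := iter t (@tm_step M) (tm_init M (pw ++ y)).

Lemma legal_run y t j : size pw + size y <= G ->
  (t == T -> cell_at ((run y t).2 ord_max) 0 = Some (inl true)) ->
  legal t j (view_of (run y t) (j%:Z - W%:Z)%R).
Proof.
move=> yG acc; rewrite /legal /view_heads /view_scan /view_here /=.
apply/and5P; split.
- by apply/eqP; lia.
- by apply/eqP; lia.
- by apply/eqP; lia.
- by apply/implyP => /eqP ->.
apply/andP; split; apply/implyP => /eqP et; last by rewrite ffunE acc // et.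
rewrite et /run /= /start_ok /view_state /view_here /= eqxx /=; apply/andP; split.
  apply/forallP => i; apply/implyP => i0; rewrite !ffunE (negbTE i0).
  by case: (_ - _)%R => k /=; rewrite nth_nil.
rewrite /input_ok /view_here /view_next /= !ffunE eqxx.
case: ltnP => jW.
  have -> : (j%:Z - W%:Z)%R = Negz (W - j).-1 by lia.
  by rewrite /= nth_nil.
have -> : (j%:Z - W%:Z)%R = Posz (j - W) by lia.
set k := j - W; have -> : (Posz k + 1)%R = Posz k.+1 by lia.
rewrite /=; set s := pw ++ y; have nths i : nth None [seq Some (inl b) | b <- s] i =
    if i < size s then Some (inl (nth false s i)) else None :> cell (tm_aux M).
  by case: ltnP => h; [rewrite (nth_map false)|rewrite nth_default ?size_map].
rewrite !nths; case ed: (drop k pw) => [|b l] /=.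
  case: ltnP => kG; first by case: ltnP => h; [case: nth|rewrite ltnNge (leqW h)]; rewrite ?orbT.
  by rewrite ltnNge size_cat (leq_trans yG kG).
have kpw : k < size pw.
  by rewrite ltnNge; apply/negP => /drop_oversize; rewrite ed.
rewrite size_cat ltn_addr // nth_cat kpw.
by have := drop_nth false kpw; rewrite ed => -[->].
Qed.

Lemma compatible_run y t j t' j' :
  compatible (t, j, view_of (run y t) (j%:Z - W%:Z)%R)
             (t', j', view_of (run y t') (j'%:Z - W%:Z)%R).
Proof.
have S i : ((i.+1)%:Z - W%:Z = i%:Z - W%:Z + 1)%R by lia.
rewrite /compatible; apply/and4P; split; apply/implyP => /andP[/eqP -> /eqP ->].
- by rewrite S hor_ok_of.
- by rewrite S hor_ok_of.
- exact: ver_ok_of.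
- exact: ver_ok_of.
Qed.

Lemma compatible_refl a : compatible a a.
Proof.
by case: a => [[t j] d] /=; rewrite !eqxx /= !(ltn_eqF (ltnSn _)).
Qed.

(** After the first blank the hypothesis propagates blanks forever, so [s] is its bit prefix
    followed by blanks, like the default of [nth]. *)
Lemma nth_bit_prefix (s : seq (cell (tm_aux M))) k :
  (forall i, i < size s ->
    [|| nth None s i == Some (inl true), nth None s i == Some (inl false)
      | (nth None s i == None) && (nth None s i.+1 == None)]) ->
  nth None s k = nth None [seq Some (inl b) | b <- bit_prefix s] k.
Proof.
elim: s k => [|c s IHs] k H; first by rewrite !nth_nil.
have {}IHs i : nth None s i = nth None [seq Some (inl b) | b <- bit_prefix s] i.
  by apply: IHs => j js; apply: (H j.+1).
have := H 0 isT; rewrite /=; case: c {H} => [[b|a]|] //= s0.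
  by case: k => [|k] //=.
have {}s0 : nth None s 0 = None by apply/eqP.
rewrite nth_nil; case: k => [//|k] /=.
move: s0 (IHs k) => /[swap] ->; rewrite (IHs 0).
by case: (bit_prefix s) => [|b l] //= _; rewrite nth_nil.
Qed.

Lemma size_bit_prefix (s : seq (cell (tm_aux M))) : size (bit_prefix s) <= size s.
Proof. by elim: s => [|[[]|] s IHs]. Qed.

Hypotheses (pwG : size pw <= G) (GW : G + T < W).

(** The guess is read off row 0, and row [t] is then shown to agree with the run in columns [t] to
    [W + W - t]. As [T < W], the head column is still covered at time [T]. *)
Lemma tableau_sound (val : nat -> nat -> view) :
  (forall t j, t <= T -> j <= W + W -> legal t j (val t j)) ->
  (forall t j t' j', t <= T -> j <= W + W -> t' <= T -> j' <= W + W ->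
     compatible (t, j, val t j) (t', j', val t' j')) ->
  exists2 y, size pw + size y <= G
    & cell_at ((run y T).2 ord_max) 0 = Some (inl true).
Proof.
move=> leg comp.
have hor t j : t <= T -> j < W + W -> hor_ok (val t j) (val t j.+1).
  move=> tT jW; have := comp t j t j.+1 tT (ltnW jW) tT jW.
  by rewrite /compatible !eqxx /= => /andP[].
have ver t j : t < T -> j <= W + W -> ver_ok (val t j) (val t.+1 j).
  move=> tT jW; have := comp t j t.+1 j (ltnW tT) jW tT jW.
  by rewrite /compatible !eqxx /= => /and4P[].
(* State and scanned symbols spread along a whole row by the horizontal constraints, borders
   included. *)
have row t j : t <= T -> j <= W + W ->
    (view_state (val t j) = view_state (val t W)) * (view_scan (val t j) = view_scan (val t W)).
  move=> tT.
  have row0 i : i <= W + W ->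
     view_state (val t i) = view_state (val t 0) /\ view_scan (val t i) = view_scan (val t 0).
    elim: i => // i IHi iW; have [<- <-] := IHi (ltnW iW).
    by have /and4P[/eqP -> /eqP ->] := hor _ _ tT iW.
  move=> /row0 [-> ->]; by have [-> ->] := row0 W (leq_addr _ _).
(* The cells of the input tape at offsets from [size pw] up to [G]; the guess is their leading block
   of bits. *)
pose s := [seq view_here (val 0 (W + (size pw + k))) ord0 | k <- iota 0 (G - size pw)].
pose y := bit_prefix s.
have size_s : size s = G - size pw by rewrite size_map size_iota.
have yG : size pw + size y <= G.
  by have := size_bit_prefix s; rewrite -/y size_s; lia.
have nth_s k : k < G - size pw -> nth None s k = view_here (val 0 (W + (size pw + k))) ord0.
  by move=> kG; rewrite (nth_map 0) ?size_iota // nth_iota.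
exists y => //.
have start j : j <= W + W -> [/\ view_state (val 0 j) = tm_start M,
     forall i, i != ord0 -> view_here (val 0 j) i = None & input_ok j (val 0 j)].
  move=> jW; have := leg 0 j isT jW.
  case/and5P=> _ _ _ _ /andP[/= /andP[/andP[/eqP -> /forallP h] ?] _].
  by split=> // i i0; have /implyP/(_ i0)/eqP := h i.
have ys k : nth None s k = nth None [seq Some (inl b) | b <- y] k.
  apply: nth_bit_prefix => i; rewrite size_s => iG; rewrite nth_s //.
  have iW : W + (size pw + i) <= W + W by lia.
  have iW' : W + (size pw + i) < W + W by lia.
  have [_ _] := start _ iW; rewrite /input_ok ltnNge leq_addr /=.
  rewrite addKn drop_oversize ?leq_addr //= ifT; last by lia.
  have /and4P[_ _ _ /eqP ->] := hor 0 _ isT iW'.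
  case/or3P=> [->|->|/andP[-> /eqP e]]; rewrite ?orbT //=.
  (* At the last cell of the zone the next entry of [s] is the default [None], as required. *)
  apply/or3P/Or33; have [i1|i1] := ltnP i.+1 (G - size pw).
    by rewrite nth_s // !addnS e.
  by rewrite nth_default ?size_s.
have inv t j : t <= T -> t <= j -> j + t <= W + W ->
    view_state (val t j) = (run y t).1 /\ view_here (val t j) = vec_at (run y t).2 (j%:Z - W%:Z)%R.
  elim: t j => [|t IHt] j tT tj jW.
    rewrite addn0 in jW; have [-> h inp] := start _ jW; split=> //.
    apply/ffunP=> i; rewrite vec_atE /run /= ffunE.
    have [->|i0] := eqVneq i ord0; last first.
      by rewrite h //; case: (_ - _)%R => k; rewrite /= nth_nil.
    move: inp; rewrite /input_ok; case: ltnP => [jlt /eqP ->|jW'].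
      have -> : (j%:Z - W%:Z)%R = Negz (W - j).-1 by lia.
      by rewrite /= nth_nil.
    have -> : (j%:Z - W%:Z)%R = Posz (j - W) by lia.
    set k := j - W; rewrite /= map_cat nth_cat size_map.
    case ed: (drop k pw) => [|b l] /=; last first.
      have kpw : k < size pw.
        by rewrite ltnNge; apply/negP => /drop_oversize; rewrite ed.
      rewrite kpw (nth_map false) //.
      by have := drop_nth false kpw; rewrite ed => -[-> _] /eqP.
    have kpw : size pw <= k.
      rewrite leqNgt; apply/negP => /(drop_nth false); by rewrite ed.
    rewrite [k < size pw]ltnNge kpw /=; case: (ltnP k G) => kG => [_|/eqP ->].
      by rewrite -ys nth_s; [rewrite !subnKC|lia].
    rewrite nth_default // size_map; lia.
  have tT' := ltnW tT.
  have /eqP e : ver_ok (val t j) (val t.+1 j) by apply: ver => //; lia.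
  (* The whole view is recovered: state and scan from column [W], the outer contents from columns
     [j.-1] and [j.+1]. Using both neighbours is what costs one column per side at each step. *)
  suff ev : val t j = view_of (run y t) (j%:Z - W%:Z)%R.
    by move: e; rewrite ev view_step_of => -[-> ->].
  have jWW : j <= W + W by lia.
  have WWW : W <= W + W by lia.
  have [qj rj] := row t j tT' jWW.
  have [qW hW] : view_state (val t W) = (run y t).1 /\
      view_here (val t W) = vec_at (run y t).2 (W%:Z - W%:Z)%R by apply: IHt => //; lia.
  have scanW : view_scan (val t W) = vec_at (run y t).2 0%R.
    have /and5P[_ /eqP h _ + _] := leg t W tT' WWW.
    by rewrite h eqxx /= => /eqP ->; rewrite hW; congr vec_at; lia.
  have [_ hj] : view_state (val t j) = (run y t).1 /\
      view_here (val t j) = vec_at (run y t).2 (j%:Z - W%:Z)%R by apply: IHt => //; lia.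
  have pj : view_prev (val t j) = vec_at (run y t).2 (j%:Z - W%:Z - 1)%R.
    have [_ h] : view_state (val t j.-1) = (run y t).1 /\
      view_here (val t j.-1) = vec_at (run y t).2 (j.-1%:Z - W%:Z)%R by apply: IHt => //; lia.
    have /and4P[_ _ /eqP h' _] : hor_ok (val t j.-1) (val t j.-1.+1) by apply: hor => //; lia.
    rewrite prednK in h'; last by lia.
    by rewrite -h' h; congr vec_at; lia.
  have nj : view_next (val t j) = vec_at (run y t).2 (j%:Z - W%:Z + 1)%R.
    have [_ h] : view_state (val t j.+1) = (run y t).1 /\
      view_here (val t j.+1) = vec_at (run y t).2 (j.+1%:Z - W%:Z)%R by apply: IHt => //; lia.
    have /and4P[_ _ _ /eqP h'] : hor_ok (val t j) (val t j.+1) by apply: hor => //; lia.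
    by rewrite h' h; congr vec_at; lia.
  have /and5P[/eqP h1 /eqP h2 /eqP h3 _ _] := leg t j tT' jWW.
  move: qj rj hj pj nj h1 h2 h3; rewrite qW scanW.
  case: (val t j) => [[[q r] [[a b] c]] [[f1 f2] f3]].
  rewrite /view_state /view_scan /view_here /view_prev /view_next /view_heads /view_of /=.
  by move=> -> -> -> -> -> -> -> ->; congr (_, _, (_, _, _), (_, _, _)); lia.
have WWW : W <= W + W by lia.
have [_ hW] : view_state (val T W) = (run y T).1 /\
      view_here (val T W) = vec_at (run y T).2 (W%:Z - W%:Z)%R by apply: inv => //; lia.
have /and5P[_ /eqP h _ + /andP[_]] := leg T W (leqnn T) WWW.
rewrite h !eqxx /= => /eqP -> /eqP <-; rewrite hW vec_atE.
by have -> : (W%:Z - W%:Z)%R = 0 by lia.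
Qed.

End Tableau.

(** * The reduction *)

Definition bool_expr (b : bool) : expr := Const [:: b].

Definition If_expr c e1 e2 : expr := Case c e2 e2 e1.

Definition Not_expr e : expr := If_expr e (bool_expr false) (bool_expr true).

Definition And_expr e1 e2 : expr := If_expr e1 e2 (bool_expr false).

Definition Imp_expr e (b : bool) : expr := If_expr e (bool_expr b) (bool_expr true).

Definition Iff_expr (b : bool) e : expr := if b then e else Not_expr e.

Definition Nonempty_expr e e1 e2 : expr := Case e e2 e1 e1.

(** Numbers are unary, so equality compares lengths: neither word outlasts the other. *)
Definition Eq_expr e1 e2 : expr :=
  Nonempty_expr (Drop e1 e2) (bool_expr false)
    (Nonempty_expr (Drop e2 e1) (bool_expr false) (bool_expr true)).

Definition Succ_expr e : expr := Cat (Const [:: true]) e.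

Definition Cats_expr (es : seq expr) : expr := foldr Cat (Const [::]) es.

(** Horner's scheme on lengths, with [s] the coefficients in increasing degree: [For] multiplies by
    the length of the variable and [Cat] adds the coefficient. *)
Fixpoint poly_expr (s : seq nat) v : expr :=
  if s is c :: s' then Cat (For (poly_expr s' v) (Var v)) (Const (nseq c true)) else Const [::].

Section EvalExpr.

Variable env : seq word.

Lemma eval_If c e1 e2 b : eval c env = [:: b] ->
  eval (If_expr c e1 e2) env = if b then eval e1 env else eval e2 env.
Proof. by move=> /= ->; case: b. Qed.

Lemma eval_Not e b : eval e env = [:: b] -> eval (Not_expr e) env = [:: ~~ b].
Proof. by move=> /eval_If ->; case: b. Qed.

Lemma eval_And e1 e2 b1 b2 : eval e1 env = [:: b1] -> eval e2 env = [:: b2] ->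
  eval (And_expr e1 e2) env = [:: b1 && b2].
Proof. by move=> /eval_If -> ->; case: b1. Qed.

Lemma eval_Imp e b c : eval e env = [:: b] ->
  eval (Imp_expr e c) env = [:: b ==> c].
Proof. by move=> /eval_If ->; case: b. Qed.

Lemma eval_Iff b e c : eval e env = [:: c] -> eval (Iff_expr b e) env = [:: b == c].
Proof. by case: b => [->|/eval_Not ->]; case: c. Qed.

Lemma eval_Nonempty e e1 e2 :
  eval (Nonempty_expr e e1 e2) env =
  if 0 < size (eval e env) then eval e1 env else eval e2 env.
Proof. by rewrite /=; case: (eval e env) => [|[]]. Qed.

Lemma eval_Eq e1 e2 :
  eval (Eq_expr e1 e2) env = [:: size (eval e1 env) == size (eval e2 env)].
Proof.
rewrite !eval_Nonempty /= !size_drop !subn_gt0.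
by case: ltngtP.
Qed.

Lemma eval_Cat e1 e2 : eval (Cat e1 e2) env = eval e1 env ++ eval e2 env.
Proof. by []. Qed.

Lemma eval_For e1 e2 :
  eval (For e1 e2) env =
  flatten [seq eval e2 (rcons env (nseq i true)) | i <- iota 0 (size (eval e1 env))].
Proof. by []. Qed.

Lemma eval_Cats es : eval (Cats_expr es) env = flatten [seq eval e env | e <- es].
Proof. by elim: es => //= e es ->. Qed.

End EvalExpr.

Lemma size_eval_poly s env v : v < size env ->
  size (eval (poly_expr s v) env) = horner_rec s (size (nth [::] env v)).
Proof.
move=> v_env; elim: s => //= c s IHs.
rewrite size_cat size_nseq IHs !natrE; congr (_ + _).
set k := horner_rec _ _; rewrite size_flatten /shape -map_comp.
have -> : [seq (size \o (fun i => nth [::] (rcons env (nseq i true)) v)) i | i <- iota 0 k]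
   = [seq size (nth [::] env v) | i <- iota 0 k].
  by apply: eq_map => i /=; rewrite nth_rcons v_env.
by rewrite -{2}(size_iota 0 k); elim: (iota _ _) => //= a l ->; rewrite mulSn.
Qed.

Lemma flatten_allpairs (S T U : Type) (g : S * T -> seq U) s t :
  flatten [seq g v | v <- [seq (x, y) | x <- s, y <- t]] =
  flatten [seq flatten [seq g (x, y) | y <- t] | x <- s].
Proof.
elim: s => //= x s IHs; rewrite map_cat flatten_cat IHs; congr (_ ++ _).
by rewrite -map_comp.
Qed.

Lemma flatten_allpairs_seq (S T U : Type) (g : S -> T -> seq U) s t :
  flatten [seq g x y | x <- s, y <- t] =
  flatten [seq flatten [seq g x y | y <- t] | x <- s].
Proof. by elim: s => //= x s IHs; rewrite flatten_cat IHs. Qed.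

Section Reduction.

Variables (M : turing_machine) (p q : {poly nat}).

Local Notation D := (view M).

(** The bounds are [T + 1] rows and [2W + 1] columns, so that the head column [W] is in the
    middle. *)
Definition loop_vars body : expr :=
  For (Succ_expr (Var 3)) (For (Succ_expr (Cat (Var 4) (Var 4))) body).

(** The views form a finite set fixed by [M], so the loop over them is unrolled and tests on views
    become constants of the term. *)
Definition loop_nodes (body : D -> expr) : expr :=
  loop_vars (Cats_expr [seq body d | d <- enum D]).

(* Variables: 0 the input, 1 its pairing prefix, 2 the guess bound G, 3 the time
   bound T, 4 the head column W, 5 and 6 the row and column of a node, 7 and 8
   those of a second node or of a skill. *)
Definition input_expr (d : D) : expr :=
  let here c := bool_expr (view_here d ord0 == c) in
  Nonempty_expr (Drop (Var 6) (Var 4)) (here None)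
    (Case (Drop (Drop (Var 4) (Var 6)) (Var 1))
      (Nonempty_expr (Drop (Drop (Var 4) (Var 6)) (Var 2))
        (bool_expr
          [|| view_here d ord0 == Some (inl true), view_here d ord0 == Some (inl false)
            | (view_here d ord0 == None) && (view_next d ord0 == None)])
        (here None))
      (here (Some (inl false))) (here (Some (inl true)))).

Definition legal_expr (d : D) : expr :=
  And_expr (Iff_expr (view_heads d).1.1 (Eq_expr (Var 6) (Succ_expr (Var 4))))
 (And_expr (Iff_expr (view_heads d).1.2 (Eq_expr (Var 6) (Var 4)))
 (And_expr (Iff_expr (view_heads d).2 (Eq_expr (Succ_expr (Var 6)) (Var 4)))
 (And_expr (bool_expr ((view_heads d).1.2 ==> (view_scan d == view_here d)))
 (And_expr (If_expr (Eq_expr (Var 5) (Const [::]))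
              (And_expr (bool_expr (start_ok d)) (input_expr d)) (bool_expr true))
           (Imp_expr (Eq_expr (Var 5) (Var 3)) (view_scan d ord_max == Some (inl true))))))).

Definition compatible_expr (d d' : D) : expr :=
  And_expr (Imp_expr (And_expr (Eq_expr (Var 5) (Var 7))
                              (Eq_expr (Var 8) (Succ_expr (Var 6))))
                    (hor_ok d d'))
 (And_expr (Imp_expr (And_expr (Eq_expr (Var 5) (Var 7))
                              (Eq_expr (Var 6) (Succ_expr (Var 8))))
                    (hor_ok d' d))
 (And_expr (Imp_expr (And_expr (Eq_expr (Var 6) (Var 8))
                              (Eq_expr (Var 7) (Succ_expr (Var 5))))
                    (ver_ok d d'))
           (Imp_expr (And_expr (Eq_expr (Var 6) (Var 8))
                              (Eq_expr (Var 5) (Succ_expr (Var 7))))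
                    (ver_ok d' d)))).

Definition same_var_expr : expr :=
  And_expr (Eq_expr (Var 5) (Var 7)) (Eq_expr (Var 6) (Var 8)).

Definition edge_expr (d d' : D) : expr :=
  let neq := Not_expr (And_expr same_var_expr (bool_expr (d == d'))) in
  Cat (And_expr neq (compatible_expr d d'))
      (And_expr neq (Not_expr (compatible_expr d d'))).

Definition skill_expr (d : D) : expr := And_expr (legal_expr d) same_var_expr.

Definition tables_expr : expr :=
  Cat (loop_nodes (fun=> bool_expr true))
 (Cat (bool_expr false)
 (Cat (loop_vars (bool_expr true))
 (Cat (bool_expr false)
 (Cat (loop_nodes (fun d => loop_nodes (edge_expr d)))
 (Cat (loop_nodes (fun d => loop_vars (skill_expr d)))
      (loop_vars (bool_expr true))))))).

(** Dropping as many bits as the unary index [Var 1] exposes the bit at that position; the empty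
    case never arises inside the loop. *)
Definition prefix_expr : expr :=
  Cat (For (Var 0) (Cat (bool_expr true)
         (Case (Drop (Var 1) (Var 0)) (Const [::]) (bool_expr false) (bool_expr true))))
      (bool_expr false).

(** Binds words of lengths [G], [T] and [W] in turn. [G] bounds the length of every admissible pair,
    [T = p(G)] the verifier's time on it, and [W = G + T + 1] meets the margin of
    [tableau_sound]. *)
Definition reduction_expr : expr :=
  Let prefix_expr
 (Let (Cat (Var 1) (poly_expr q 0))
 (Let (poly_expr p 2)
 (Let (Succ_expr (Cat (Var 2) (Var 3)))
      tables_expr))).

Definition tableau_vars T W : seq (nat * nat) :=
  [seq (t, j) | t <- iota 0 T.+1, j <- iota 0 (W + W).+1].

Definition tableau_nodes T W : seq (nat * nat * D) :=
  [seq (v, d) | v <- tableau_vars T W, d <- enum D].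

Lemma tableau_nodes_uniq T W : uniq (tableau_nodes T W).
Proof.
apply: allpairs_uniq => //; [apply: allpairs_uniq | exact: enum_uniq |]; rewrite ?iota_uniq //.
  by case=> [a b] [c d] _ _ /=.
by case=> [a b] [c d] _ _ /=.
Qed.

Definition tableau_instance pw G T W : tfsnc_instance :=
  complete_instance (tableau_nodes T W) (tableau_vars T W)
    (fun a v => legal pw G T W a.1.1 a.1.2 a.2 && (a.1 == v))
    (@compatible_sym M).

Section Tables.

Variables (x pw G T W : word).

Definition ruler (v : nat * nat) : seq word := [:: nseq v.1 true; nseq v.2 true].

Lemma eval_loop_vars body env :
  eval (loop_vars body) ([:: x; pw; G; T; W] ++ env) =
  flatten [seq eval body ([:: x; pw; G; T; W] ++ env ++ ruler v)
          | v <- tableau_vars (size T) (size W)].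
Proof.
rewrite /tableau_vars flatten_allpairs /loop_vars eval_For.
congr flatten; apply: eq_map => t; rewrite eval_For.
have -> : size (eval (Succ_expr (Cat (Var 4) (Var 4)))
    (rcons ([:: x; pw; G; T; W] ++ env) (nseq t true))) = (size W + size W).+1.
  by rewrite /= size_cat.
by congr flatten; apply: eq_map => j; rewrite -!cats1 -!catA.
Qed.

Lemma eval_loop_nodes body env :
  eval (loop_nodes body) ([:: x; pw; G; T; W] ++ env) =
  flatten [seq eval (body a.2) ([:: x; pw; G; T; W] ++ env ++ ruler a.1)
          | a <- tableau_nodes (size T) (size W)].
Proof.
rewrite /loop_nodes eval_loop_vars /tableau_nodes [RHS]flatten_allpairs.
congr flatten; apply: eq_map => v.
by rewrite eval_Cats -map_comp.
Qed.

Lemma eval_legal v d env :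
  eval (legal_expr d) ([:: x; pw; G; T; W] ++ ruler v ++ env) =
  [:: legal pw (size G) (size T) (size W) v.1 v.2 d].
Proof.
case: v => t j; rewrite /legal /ruler.
apply: eval_And; first by apply: eval_Iff; rewrite eval_Eq /= size_nseq.
apply: eval_And; first by apply: eval_Iff; rewrite eval_Eq /= size_nseq.
apply: eval_And; first by apply: eval_Iff; rewrite eval_Eq /= size_nseq.
apply: eval_And => //.
apply: eval_And; last by apply: eval_Imp; rewrite eval_Eq /= size_nseq.
set env' := _ ++ _.
have e0 : eval (Eq_expr (Var 5) (Const [::])) env' = [:: t == 0].
  by rewrite eval_Eq /= size_nseq.
rewrite (eval_If _ _ e0) {e0}; case: eqP => // _; apply: eval_And => //.
rewrite /input_expr eval_Nonempty /input_ok.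
have -> : size (eval (Drop (Var 6) (Var 4)) env') = size W - j.
  by rewrite /= size_drop size_nseq.
rewrite subn_gt0; case: ltnP => // _.
rewrite /= !size_drop size_nseq; case: (drop _ pw) => [|[] l] //.
rewrite -[j - size W < size G]subn_gt0 -size_drop.
by case: (drop _ G) => [|[]].
Qed.

Lemma eval_same_var v v' :
  eval same_var_expr ([:: x; pw; G; T; W] ++ ruler v ++ ruler v') = [:: v == v'].
Proof.
case: v v' => [t j] [t' j']; rewrite xpair_eqE.
by apply: eval_And; rewrite eval_Eq /= !size_nseq.
Qed.

Lemma eval_compatible a b :
  eval (compatible_expr a.2 b.2) ([:: x; pw; G; T; W] ++ ruler a.1 ++ ruler b.1) =
  [:: compatible a b].
Proof.
case: a b => [[t j] d] [[t' j'] d']; rewrite /compatible.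
by do 3![apply: eval_And;
    first by apply: eval_Imp; apply: eval_And; rewrite eval_Eq /= !size_nseq];
  apply: eval_Imp; apply: eval_And; rewrite eval_Eq /= !size_nseq.
Qed.

Lemma eval_edge a b :
  eval (edge_expr a.2 b.2) ([:: x; pw; G; T; W] ++ ruler a.1 ++ ruler b.1) =
  [:: (a != b) && compatible a b; (a != b) && ~~ compatible a b].
Proof.
have neq : eval (Not_expr (And_expr same_var_expr (bool_expr (a.2 == b.2))))
    ([:: x; pw; G; T; W] ++ ruler a.1 ++ ruler b.1) = [:: a != b].
  by apply: eval_Not; case: a b => [v d] [v' d']; rewrite xpair_eqE;
     apply: eval_And; rewrite ?eval_same_var.
rewrite /edge_expr eval_Cat.
by rewrite (eval_And neq (eval_compatible a b)) (eval_And neq (eval_Not (eval_compatible a b))).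
Qed.

Lemma cat_congr (s1 s2 t1 t2 : word) : s1 = t1 -> s2 = t2 -> s1 ++ s2 = t1 ++ t2.
Proof. by move=> -> ->. Qed.

Lemma map_const_nseq (S U : Type) (u : U) (l : seq S) :
  [seq u | _ <- l] = nseq (size l) u.
Proof. by elim: l => //= _ l ->. Qed.

Lemma flatten_map_singleton (S : Type) (g : S -> word) h l :
  (forall a, g a = [:: h a]) -> flatten [seq g a | a <- l] = [seq h a | a <- l].
Proof. by move=> gh; elim: l => //= a l ->; rewrite gh. Qed.

Lemma eval_tables :
  eval tables_expr [:: x; pw; G; T; W] =
  tfsnc_encode (tableau_instance pw (size G) (size T) (size W)).
Proof.
have LN body := eval_loop_nodes body [::].
have LV body := eval_loop_vars body [::].
rewrite cats0 in LN LV.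
have ones_vars : eval (loop_vars (bool_expr true)) [:: x; pw; G; T; W] =
    nseq (size (tableau_vars (size T) (size W))) true.
  by rewrite LV (flatten_map_singleton (h := fun=> true)) // map_const_nseq.
rewrite encode_complete_instance; last exact: tableau_nodes_uniq.
rewrite /tables_expr.
rewrite eval_Cat; apply: cat_congr.
  by rewrite LN (flatten_map_singleton (h := fun=> true)) // map_const_nseq.
rewrite eval_Cat; apply: (cat_congr (t1 := [:: false])) => //.
rewrite eval_Cat; apply: cat_congr; first exact: ones_vars.
rewrite eval_Cat; apply: (cat_congr (t1 := [:: false])) => //.
rewrite eval_Cat; apply: cat_congr.
  rewrite LN flatten_allpairs_seq; congr flatten; apply: eq_map => a.
  rewrite eval_loop_nodes; congr flatten; apply: eq_map => b; exact: eval_edge.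
rewrite eval_Cat; apply: cat_congr; last exact: ones_vars.
rewrite LN; congr flatten; apply: eq_map => a.
rewrite eval_loop_vars; apply: flatten_map_singleton => v.
by apply: eval_And; [exact: eval_legal | exact: eval_same_var].
Qed.

End Tables.

Lemma eval_prefix x : eval prefix_expr [:: x] = word_pair x [::].
Proof.
rewrite /prefix_expr eval_Cat eval_For /word_pair; congr (_ ++ _).
have -> : size (eval (Var 0) [:: x]) = size x by [].
rewrite -[in RHS](mkseq_nth false x) /mkseq -map_comp; congr flatten.
apply/eq_in_map => i; rewrite mem_iota add0n => /andP[_ ix] /=.
rewrite size_nseq (drop_nth false ix) /=.
by case: (nth false x i).
Qed.

Lemma eval_reduction x :
  let pw := word_pair x [::] in
  let G := size pw + q.[size x]%R in
  let T := p.[G]%R in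
  eval reduction_expr [:: x] = tfsnc_encode (tableau_instance pw G T (G + T).+1).
Proof.
move=> pw G T.
pose Gw := pw ++ eval (poly_expr q 0) [:: x; pw].
pose Tw := eval (poly_expr p 2) [:: x; pw; Gw].
have sG : size Gw = G by rewrite size_cat size_eval_poly.
have sT : size Tw = T by rewrite size_eval_poly //= sG.
have -> : eval reduction_expr [:: x] =
    eval tables_expr [:: x; pw; Gw; Tw; true :: Gw ++ Tw].
  by rewrite /Tw /Gw /pw -eval_prefix.
by rewrite eval_tables /= size_cat sG sT.
Qed.

End Reduction.

Section TableauInstance.

Variables (Comp : compatibility_rule) (M : turing_machine).
Variables (pw : word) (G T W : nat).
Hypothesis Comp_refl : forall (V : finType) (H : connected_signed_graph V) (u : V), @Comp V H u u.
Hypothesis Comp_pos : forall (V : finType) (H : connected_signed_graph V) (u v : V),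
  (u, v, true) \in edges H -> @Comp V H u v.
Hypothesis Comp_neg : forall (V : finType) (H : connected_signed_graph V) (u v : V),
  (u, v, false) \in edges H -> ~ @Comp V H u v.
Hypotheses (pwG : size pw <= G) (GW : G + T < W).

Lemma mem_tableau_vars t j :
  ((t, j) \in tableau_vars T W) = (t <= T) && (j <= W + W).
Proof.
apply/allpairsP/andP => [[ab []]|[tT jW]].
  by rewrite !mem_iota => ? ? [-> ->].
by exists (t, j); split; rewrite // mem_iota.
Qed.

Lemma tableau_instance_yes :
  tfsnc_yes Comp (tableau_instance M pw G T W) <->
  exists2 y, size pw + size y <= G
    & cell_at ((run M pw y T).2 ord_max) 0 = Some (inl true).
Proof.
have mem_node a : (a \in tableau_nodes M T W) = (a.1 \in tableau_vars T W).
  apply/allpairsP/idP => [[[v d] [/= v_in _ ->]] //|a_in].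
  by exists a; split=> //; [rewrite mem_enum|case: a {a_in}].
have yesE := complete_instance_yes (tableau_vars T W)
  (fun a v => legal pw G T W a.1.1 a.1.2 a.2 && (a.1 == v))
  (tableau_nodes_uniq M T W) (@compatible_sym M) Comp_refl Comp_pos Comp_neg.
apply: (iff_trans yesE); split.
- case=> X [cov comp].
  have {}cov t j : t <= T -> j <= W + W ->
      exists d, X (t, j, d) && legal pw G T W t j d.
    move=> tT jW; have tj : (t, j) \in tableau_vars T W by rewrite mem_tableau_vars tT.
    have [[v d] _ /= /and3P[Xa leg /eqP ev]] := cov _ tj.
    by exists d; move: Xa leg; rewrite ev => -> ->.
  have [d0 _] := cov 0 0 isT isT.
  pose val t j := odflt d0 [pick d | X (t, j, d) && legal pw G T W t j d].
  have valP t j : t <= T -> j <= W + W -> X (t, j, val t j) && legal pw G T W t j (val t j).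
    move=> tT jW; rewrite /val; case: pickP => //= no.
    by have [d] := cov _ _ tT jW; have /= -> := no d.
  apply: (tableau_sound pwG GW (val := val)).
    by move=> t j tT jW; have /andP[] := valP _ _ tT jW.
  move=> t j t' j' tT jW tT' jW'.
  have /andP[X1 _] := valP _ _ tT jW; have /andP[X2 _] := valP _ _ tT' jW'.
  (* The team condition concerns distinct nodes only; a node is compatible with itself. *)
  have [->|ne] := eqVneq (t, j, val t j) (t', j', val t' j'); first exact: compatible_refl.
  by apply: comp => //; rewrite mem_node mem_tableau_vars ?tT ?tT'.
- case=> y yG acc.
  (* The team of an accepting run consists of its true views, one per variable. *)
  exists (fun a => a.2 == view_of (run M pw y a.1.1) (a.1.2%:Z - W%:Z)%R); split.
    case=> t j; rewrite mem_tableau_vars => tj.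
    exists (t, j, view_of (run M pw y t) (j%:Z - W%:Z)%R).
      by rewrite mem_node mem_tableau_vars.
    rewrite /= !eqxx andbT /=; apply: legal_run => //.
    by move=> /eqP ->.
  move=> [[t j] d] [[t' j'] d'] _ _ /eqP /= -> /eqP -> _.
  exact: compatible_run.
Qed.

End TableauInstance.

Lemma iter_tm_step_halted (M : turing_machine) (c : config M) n :
  tm_halted c.1 -> iter n (@tm_step M) c = c.
Proof.
by move=> h; elim: n => //= n ->; case: c h => q t /= h; rewrite /tm_step h.
Qed.

Lemma cell_at_tape_word (M : turing_machine) (t : tape (tm_aux M)) b :
  (cell_at t 0 = Some (inl b)) <-> (ohead (tape_word t) = Some b).
Proof.
case: t => l [|[[c|a]|] r]; rewrite /tape_word /=; split=> //.
  by case=> ->.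
by case=> ->.
Qed.

Theorem theorem2p2 (Comp : compatibility_rule)
  (Comp_refl : forall (V : finType) (G : connected_signed_graph V) (u : V),
     Comp V G u u)
  (Comp_sym : forall (V : finType) (G : connected_signed_graph V) (u v : V),
     Comp V G u v -> Comp V G v u)
  (Comp_pos : forall (V : finType) (G : connected_signed_graph V) (u v : V),
     (u, v, true) \in edges G -> Comp V G u v)
  (Comp_neg : forall (V : finType) (G : connected_signed_graph V) (u v : V),
     (u, v, false) \in edges G -> ~ Comp V G u v) :
  NP_hard (TFSNC Comp).
Proof.
move=> L [V [q [[f [M [p Mf]] fV] LV]]].
exists (fun x => eval (reduction_expr M p q) [:: x]); first exact: polytime_expr.
move=> x; rewrite eval_reduction.
set pw := word_pair x [::]; set G := size pw + _; set T := p.[G]%R.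
have yes := @tableau_instance_yes Comp M pw G T (G + T).+1 Comp_refl Comp_pos Comp_neg
  (leq_addr _ _) (ltnSn _).
(* The pairing puts [y] last, so the guess simply extends the known prefix [pw]. *)
have pwE y : pw ++ y = word_pair x y by rewrite /pw /word_pair -catA.
have accepts y : size pw + size y <= G ->
    V (word_pair x y) <-> cell_at ((run M pw y T).2 ord_max) 0 = Some (inl true).
  move=> yG; apply: (iff_trans _ (iff_sym (cell_at_tape_word _ _))).
  rewrite /run pwE.
  have := Mf (word_pair x y); rewrite /tm_outputs_within.
  set n := p.[_]%R; case e : (iter n _ _) => [st tp] [halt out].
  (* The machine halts within [n] steps and then stays put, so its configuration at time [T] carries
     the same output for every guess length. *)
  have nT : n <= T by apply: leq_horner; rewrite -pwE size_cat.
  rewrite -(subnK nT) iterD e iter_tm_step_halted //= out.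
  have [yesV noV] := fV (word_pair x y); split=> [/yesV -> //|fx].
  (* Membership in [V] is a mere proposition, so excluded middle turns the first output bit [true]
     into acceptance. *)
  by apply: NNPP => /noV fx'; move: fx; rewrite fx'.
rewrite LV; split.
- case=> y yq Vy; exists (tableau_instance M pw G T (G + T).+1) => //.
  apply/yes; have yG : size pw + size y <= G by rewrite leq_add2l.
  by exists y => //; apply/accepts.
(* Injectivity of the encoding identifies the instance behind the word with the tableau instance. *)
- case=> I /tfsnc_encode_inj <- /yes[y yG /(accepts _ yG) Vy].
  by exists y => //; move: yG; rewrite leq_add2l.
Qed.
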